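(* Let $\mathcal{F}=\{\mathcal{F}_t : t\ge 0\}$ be a filtration satisfying the usual conditions on a probability space $(\Omega,\mathfrak{A},\mathbb{P})$. Let $X=\{X_t:t\ge 0\}$ be a continuous $\mathcal{F}_t$-submartingale with $X_0=0$ and $\mathbb{P}\{X_t\ge 0,\ \forall t\}=1$, whose Doob-Meyer decomposition is $X_t=M_t+A_t$, $t\ge 0$, where $M$ is a square-integrable continuous $\mathcal{F}_t$-martingale with $M_0=0$ and $A$ is an increasing (integrable) natural process with $A_0=0$. Let $\langle M\rangle$ be the quadratic variation of $M$, let $X_t^{*}=\max_{s\le t}X_s$, and suppose that $\mathbb{P}\{X_t^{*}>0\}=1$ for every $t>0$. Fix $\varepsilon>0$. 1. Suppose that the function $\phi:(0,+\infty)\to\mathbb{R}$ is of class $C^1$, non-increasing, and such that $$\mathbb{E}\Big[\int_{\varepsilon}^{T}\phi(X_s^{*})^2\,d\langle M\rangle_s\Big]<+\infty\quad\text{for every }T>\varepsilon .$$ For every $x\ge z>0$ set $$\Phi(x,z)=-\int_z^x y\,\phi'(y)\,dy .$$ Then, for every $\alpha\ge 1$, the process $$Z_{\varepsilon}(\phi,\alpha;t)=\phi(X_t^{*})(X_t-A_t)+\alpha\,\Phi(X_t^{*},X_{\varepsilon}^{*}),\qquad t\ge\varepsilon,$$ is an $\mathcal{F}_t$-submartingale on $[\varepsilon,+\infty)$. 2. Suppose that the function $\phi:(0,+\infty)\to\mathbb{R}$ is of class $C^1$, non-decreasing, and such that $$\mathbb{E}\Big[\int_{\varepsilon}^{T}\phi(X_s^{*})^2\,d\langle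 M\rangle_s\Big]<+\infty\quad\text{for every }T>\varepsilon .$$ Define $\Phi$ and $Z_\varepsilon(\phi,\alpha;t)$ by the same formulas as in part 1. Then, for every $\alpha\ge 1$, the process $Z_{\varepsilon}(\phi,\alpha;t)$, $t\ge\varepsilon$, is an $\mathcal{F}_t$-supermartingale on $[\varepsilon,+\infty)$.
   Context: The function $\phi$ (and $\phi'$) need not be defined at $0$.
   Formalization: Sub/supermartingale here means adapted with the conditional inequality for extended conditional expectations; integrability of Z_t is not claimed, as it can fail: X_t=ξ|B_{t∧ε}|, ξ∈(0,1] F_0-measurable, independent of B, E[1/ξ]=∞, φ(x)=x^{-2}. *)

(* Defs.v *)
From HB Require Import structures.
From mathcomp Require Import all_boot all_order all_algebra.
From mathcomp Require Import all_classical all_reals all_analysis.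
From mathcomp Require Import measurable_realfun.

Set Implicit Arguments.
Unset Strict Implicit.
Unset Printing Implicit Defensive.

Import Order.TTheory GRing.Theory Num.Theory.
Import numFieldNormedType.Exports.
Local Open Scope classical_set_scope.
Local Open Scope ring_scope.

(* Processes are functions [R -> T -> R] of time and outcome, and filtrations
   are functions [R -> set (set T)] of time; only times [0 <= t] (or [a <= t],
   for a process on [a, +oo[) are ever constrained.  Properties of sample paths
   are required almost surely. *)

Section Processes.
Context {d : measure_display} {T : measurableType d} {R : realType}.
Variable P : probability T R.

Definition filtration (F : R -> set (set T)) : Prop :=
  (forall t, 0 <= t ->
     sigma_algebra [set: T] (F t) /\ F t `<=` d.-measurable) /\
  (forall s t, 0 <= s -> s <= t -> F s `<=` F t).

(* Since [F 0] only contains measurable sets and [P.-negligible] sets are the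
   subsets of measurable null sets, the second clause makes [P] complete. *)
Definition usual_conditions (F : R -> set (set T)) : Prop :=
  [/\ filtration F,
      P.-negligible `<=` F 0 &
      forall t E, 0 <= t -> (forall s, t < s -> F s E) -> F t E].

Definition measurable_wrt (G : set (set T)) d' (U : measurableType d')
    (f : T -> U) : Prop :=
  forall B, measurable B -> G (f @^-1` B).

Definition adapted (a : R) (F : R -> set (set T)) (Z : R -> T -> R) : Prop :=
  forall t, a <= t -> measurable_wrt (F t) (Z t).

Definition integrable_process (a : R) (Z : R -> T -> R) : Prop :=
  forall t, a <= t -> P.-integrable setT (EFin \o Z t).

Definition is_cond_exp_nneg (G : set (set T)) (Y W : T -> \bar R) : Prop :=
  [/\ forall w, (0 <= W w)%E, measurable_wrt G W &
      forall E, G E -> (\int[P]_(w in E) W w = \int[P]_(w in E) Y w)%E].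

(* [W] is a version of E[Y | G], where E[Y | G] = E[Y^+ | G] - E[Y^- | G]
   exists as soon as almost surely at most one of the two terms is infinite
   (the extended conditional expectation).  If [Y] is integrable this is the
   usual conditional expectation. *)
Definition is_cond_exp (G : set (set T)) (Y W : T -> \bar R) : Prop :=
  exists U V : T -> \bar R,
    [/\ is_cond_exp_nneg G (Y^\+)%E U, is_cond_exp_nneg G (Y^\-)%E V,
        {ae P, forall w, (U w < +oo)%E \/ (V w < +oo)%E} &
        {ae P, forall w, W w = (U w - V w)%E}].

(* Generalized sub- and supermartingales on [a, +oo[: the process is adapted,
   the conditional expectations E[Z_t | F_s] exist (in the extended sense) and
   satisfy the sub/supermartingale inequality.  Integrability of [Z t] is not
   part of the notion; together with it one gets the classical notion.
   For the processes [Zproc] below integrability may fail: take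
   X_t = xi |B_{min(t,eps)}| with B a Brownian motion, xi > 0 bounded,
   independent of B and F_0-measurable, E[1/xi] = +oo, and phi(x) = x^-2;
   then Z_t is the constant variable phi(X_eps^* )(X_eps - A_eps) for
   t >= eps, which is not integrable. *)
Definition gen_submartingale (a : R) (F : R -> set (set T)) (Z : R -> T -> R)
    : Prop :=
  adapted a F Z /\
  forall s t, a <= s -> s <= t ->
    exists W, is_cond_exp (F s) (EFin \o Z t) W /\
              {ae P, forall w, ((Z s w)%:E <= W w)%E}.

Definition gen_supermartingale (a : R) (F : R -> set (set T)) (Z : R -> T -> R)
    : Prop :=
  adapted a F Z /\
  forall s t, a <= s -> s <= t ->
    exists W, is_cond_exp (F s) (EFin \o Z t) W /\
              {ae P, forall w, (W w <= (Z s w)%:E)%E}.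

Definition submartingale (a : R) (F : R -> set (set T)) (Z : R -> T -> R)
    : Prop :=
  integrable_process a Z /\ gen_submartingale a F Z.

Definition martingale (a : R) (F : R -> set (set T)) (Z : R -> T -> R) : Prop :=
  [/\ integrable_process a Z, adapted a F Z &
      forall s t, a <= s -> s <= t ->
        is_cond_exp (F s) (EFin \o Z t) (EFin \o Z s)].

Definition right_continuous_path (x : R -> R) : Prop :=
  forall t, 0 <= t -> x s @[s --> t^'+] --> x t.

Definition continuous_paths (X : R -> T -> R) : Prop :=
  {ae P, forall w, {within `[0, +oo[, continuous (fun t => X t w)}}.

Definition square_integrable (M : R -> T -> R) : Prop :=
  forall t, 0 <= t -> P.-integrable setT (fun w => ((M t w) ^+ 2)%:E).

(* The Lebesgue-Stieltjes measure of a path [x] that is nondecreasing and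
   right-continuous on [0, +oo[ (extended by [x 0] to negative times, so that
   the measure lives on ]0, +oo[); the zero measure for any other path. *)
Definition stieltjes (x : R -> R) : {measure set (measurableTypeR R) -> \bar R} :=
  match pselect (exists f : cumulative R R, forall t, f t = x (Num.max 0 t)) with
  | left h => lebesgue_stieltjes_measure (projT1 (cid h))
  | right _ => mzero
  end.

Definition increasing_process (F : R -> set (set T)) (A : R -> T -> R) : Prop :=
  [/\ adapted 0 F A,
      integrable_process 0 A,
      {ae P, forall w, A 0 w = 0},
      {ae P, forall w, forall s t, 0 <= s -> s <= t -> A s w <= A t w} &
      {ae P, forall w, right_continuous_path (fun t => A t w)}].

(* E \int_]0,t] m_s dA_s = E \int_]0,t] m_{s-} dA_s for every bounded
   right-continuous martingale m. *)
Definition natural_process (F : R -> set (set T)) (A : R -> T -> R) : Prop :=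
  forall m : R -> T -> R,
    martingale 0 F m ->
    (exists C : R, forall (t : R) w, 0 <= t -> `|m t w| <= C) ->
    {ae P, forall w, right_continuous_path (fun t => m t w)} ->
    forall t : R, 0 < t ->
      (\int[P]_w \int[stieltjes (fun s => A s w)]_(s in `]0%R, t]) (m s w)%:E =
       \int[P]_w \int[stieltjes (fun s => A s w)]_(s in `]0%R, t])
          (lim (m r w @[r --> s^'-]))%:E)%E.

Definition doob_meyer (F : R -> set (set T)) (X M A : R -> T -> R) : Prop :=
  [/\ {ae P, forall w, forall t, 0 <= t -> X t w = M t w + A t w},
      [/\ martingale 0 F M, square_integrable M, continuous_paths M &
          {ae P, forall w, M 0 w = 0}] &
      increasing_process F A /\ natural_process F A].

(* The quadratic variation <M> of a continuous square-integrable martingale,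
   by its characterization up to indistinguishability. *)
Definition quadratic_variation (F : R -> set (set T)) (M Q : R -> T -> R)
    : Prop :=
  [/\ increasing_process F Q, continuous_paths Q &
      martingale 0 F (fun t w => (M t w) ^+ 2 - Q t w)].

Definition running_max (X : R -> T -> R) (t : R) (w : T) : R :=
  sup [set X s w | s in `[0, t]].

Definition finite_energy (eps : R) (phi : R -> R) (X Q : R -> T -> R) : Prop :=
  forall t : R, eps < t ->
    (\int[P]_w \int[stieltjes (fun s => Q s w)]_(s in `[eps, t])
        ((phi (running_max X s w)) ^+ 2)%:E < +oo)%E.

End Processes.

(* Functions on ]0, +oo[ are total functions whose values on ]-oo, 0] are
   irrelevant. *)
Definition C1_pos {R : realType} (phi : R -> R) : Prop :=
  forall x : R, 0 < x ->
    derivable phi x 1 /\ {for x, continuous (derive1 phi)}.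

Definition nonincreasing_pos {R : realType} (phi : R -> R) : Prop :=
  forall x y : R, 0 < x -> x <= y -> phi y <= phi x.

Definition nondecreasing_pos {R : realType} (phi : R -> R) : Prop :=
  forall x y : R, 0 < x -> x <= y -> phi x <= phi y.

Definition Phi {R : realType} (phi : R -> R) (x z : R) : R :=
  - \int[lebesgue_measure]_(y in `[z, x]) (y * derive1 phi y).

Definition Zproc {d : measure_display} {T : measurableType d} {R : realType}
    (X A : R -> T -> R) (eps : R) (phi : R -> R) (alpha t : R) (w : T) : R :=
  phi (running_max X t w) * (X t w - A t w)
  + alpha * Phi phi (running_max X t w) (running_max X eps w).

(* Main.v *)
(* For s < t discretise [s, t] by t_i and write S for the running maximum.
   Summation by parts gives
     phi(S_t) M_t - phi(S_s) M_s
       = sum_i phi(S_{t_i}) (M_{t_{i+1}} - M_{t_i})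
         + sum_i M_{t_{i+1}} (phi(S_{t_{i+1}}) - phi(S_{t_i})).
   When phi is nonincreasing, M = X - A <= S bounds the last sum below by
   - Phi(S_t, S_s), up to an error that vanishes with the mesh because S is
   continuous.  As alpha >= 1 and Phi >= 0, the increment Z_t - Z_s thus
   dominates martingale transforms I_n up to a vanishing error.  On the events
   {phi(S_s) <= m} of F_s the I_n (with phi(S) truncated at -n) are centred given
   F_s and bounded in L^2 by the energy hypothesis.  Fatou's lemma applied to
   (k - I_n)^+ <= k - I_n + I_n^2 / k, followed by k -> +oo, shows that
   E[(Z_t - Z_s)^-; E] <= E[(Z_t - Z_s)^+; E], with a finite left-hand side, for
   every E in F_s inside such an event.  This replaces the stochastic integral
   of phi(S) against M.  The nondecreasing case is the nonincreasing one for
   - phi. *)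

Require Import Defs.
From HB Require Import structures.
From mathcomp Require Import all_boot all_order all_algebra.
From mathcomp Require Import all_classical all_reals all_analysis.
From mathcomp Require Import measurable_realfun.
From mathcomp Require Import ring lra.

Set Implicit Arguments.
Unset Strict Implicit.
Unset Printing Implicit Defensive.

Import Order.TTheory GRing.Theory Num.Theory.
Import numFieldNormedType.Exports.
Local Open Scope classical_set_scope.
Local Open Scope ring_scope.

(** Since [phi] may blow up at 0 and S_s may be arbitrarily small, Z_s need not be integrable, and
    no bound on the positive part of Z_t - Z_s is available. Hence the inequality is tested on sets
    of F_s in the form: the negative part of the increment has a finite integral, at most that of
    the positive part. This keeps its meaning when the latter is infinite, and the events {phi(S_s)
    <= m} exhaust the space. The L^2 bound has to reconcile two sampling times: the isometry
    produces phi(S_{t_i})^2, whereas the energy controls phi(S_u)^2 for u in ]t_i, t_{i+1}]. As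
    phi(S) decreases in time, a positive phi(S_{t_i}) is at most phi(S_s) <= m, and a negative one
    has modulus at most |phi(S_u)|; so phi(S_{t_i})^2 <= m^2 + phi(S_u)^2. The truncation at -n
    makes the coefficients bounded, so that the isometry applies; on each path it is inactive for
    large n, because phi(S) >= phi(S_t) up to time t. *)

Ltac max_lra :=
  rewrite /Num.max /Num.min; repeat (case: ifPn); rewrite -?leNgt => *; lra.

(** * Conditional expectation *)

Lemma maxrN0 (R : realDomainType) (x : R) : Num.max x 0 - Num.max (- x) 0 = x.
Proof. by max_lra. Qed.

Section SubSigmaAlgebra.
Context {d : measure_display} {T : measurableType d} {R : realType}.
Variables (P : probability T R) (G : set (set T)).
Hypotheses (sG : sigma_algebra [set: T] G) (Gm : G `<=` d.-measurable).

(** Puts [G]-measurability in the form to which the closure lemmas on measurable functions apply;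
    [G] is already a sigma-algebra, so generating from it adds no set. *)
Lemma measurable_wrtP d' (U : measurableType d') (f : T -> U) :
  measurable_wrt G f <->
  measurable_fun [set: g_sigma_algebraType G] (f : g_sigma_algebraType G -> U).
Proof.
have GE : G.-sigma.-measurable = G by exact: measurable_g_measurableTypeE.
split=> [mf _ B mB|mf B mB]; first by rewrite setTI GE; exact: mf.
by rewrite -GE -[X in measurable X]setTI; exact: mf.
Qed.

Lemma measurable_wrt_fun d' (U : measurableType d') (f : T -> U) :
  measurable_wrt G f -> measurable_fun [set: T] f.
Proof. by move=> mf _ B mB; rewrite setTI; apply/Gm/mf. Qed.

Lemma measurable_wrt_setP (E : set T) :
  G E <-> (measurable : set (set (g_sigma_algebraType G))) E.
Proof. by rewrite [measurable]measurable_g_measurableTypeE. Qed.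

(** The pushforward of [P] along this identity map is the restriction of [P] to [G], now a measure
    on a measurable type of its own. *)
Lemma measurable_idG : measurable_fun [set: T] (idfun : T -> g_sigma_algebraType G).
Proof. by move=> _ B mB; rewrite setTI; exact/Gm/measurable_wrt_setP. Qed.

Let idGmix := isMeasurableFun.Build _ _ _ _ _ measurable_idG.
Let idG : {mfun T >-> g_sigma_algebraType G} :=
  HB.pack (idfun : T -> g_sigma_algebraType G) idGmix.

Lemma integral_sub (E : set T) (f : T -> \bar R) :
  G E -> measurable_wrt G f -> (forall w, 0 <= f w)%E ->
  (\int[distribution P idG]_(w in E) f w = \int[P]_(w in E) f w)%E.
Proof.
move=> GE mf f0; rewrite ge0_integral_pushforward//.
- exact/measurable_wrt_setP.
- by apply: measurable_funTS; exact/measurable_wrtP.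
Qed.


Section ConditionalExpectation.
Variable Y : T -> \bar R.
Hypotheses (mY : measurable_fun [set: T] Y) (Y0 : forall w, (0 <= Y w)%E).
Hypothesis iY : (\int[P]_w Y w < +oo)%E.

Definition density_sub (E : set (g_sigma_algebraType G)) : \bar R :=
  (\int[P]_(w in E) Y w)%E.

Let density_sub0 : density_sub set0 = 0%E.
Proof. exact: integral_set0. Qed.

Let density_sub_ge0 E : (0 <= density_sub E)%E.
Proof. by apply: integral_ge0 => w _; exact: Y0. Qed.

Let density_sub_sigma_additive : semi_sigma_additive density_sub.
Proof.
move=> B mB tB mUB; apply: semi_sigma_additive_nng_induced => //.
- by move=> i; exact/Gm/measurable_wrt_setP.
- exact/Gm/measurable_wrt_setP.
Qed.

HB.instance Definition _ := isMeasure.Build _ _ _ density_sub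
  density_sub0 density_sub_ge0 density_sub_sigma_additive.

Let density_sub_fin : fin_num_fun density_sub.
Proof.
move=> E /measurable_wrt_setP GE; rewrite ge0_fin_numE//.
apply: le_lt_trans iY; apply: ge0_subset_integral => //; exact: Gm.
Qed.

HB.instance Definition _ := Measure_isFinite.Build _ _ _ density_sub
  density_sub_fin.

(** The version is the Radon-Nikodym density, on the sub-sigma-algebra, of the finite measure
    [density_sub] with respect to the restriction of [P]. *)
Lemma cond_exp_nneg_fin : exists W, is_cond_exp_nneg P G Y W.
Proof.
have [|W [W0 iW WE]] := @radon_nikodym_finite _ _ _ (distribution P idG) density_sub.
  apply/null_content_dominatesP => E mE PE0; rewrite /density_sub.
  have GE : G E by exact/measurable_wrt_setP.
  apply: null_set_integral => //; last exact: measurable_funTS.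
  exact: Gm.
have mW : measurable_wrt G W.
  by apply/measurable_wrtP; exact: (measurable_int _ iW).
exists W; split => // E GE.
rewrite -integral_sub// -WE//; exact/measurable_wrt_setP.
Qed.

End ConditionalExpectation.

(** [Y] is cut into slices between consecutive integers; each is bounded, hence integrable, and the
    conditional expectations of the slices are summed. As [Y] is finite, every point lies in exactly
    one slice. *)
Lemma cond_exp_nneg_exists (Y : T -> \bar R) :
  measurable_fun setT Y -> (forall w, 0 <= Y w < +oo)%E ->
  exists W, is_cond_exp_nneg P G Y W.
Proof.
move=> mY Y0.
pose A k := [set w | k%:R%:E <= Y w < k.+1%:R%:E]%E.
have mA k : measurable (A k).
  rewrite /A (_ : [set w | _] = [set w | k%:R%:E <= Y w]%E `&` [set w | Y w < k.+1%:R%:E]%E).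
    by apply: measurableI; rewrite -[X in measurable X]setTI;
      [exact: emeasurable_fun_c_infty|exact: emeasurable_fun_infty_o].
  by apply/seteqP; split=> w /=; [move=> /andP[]|move=> [-> ->]].
pose Yk k := Y \_ (A k).
have Yk0 k w : (0 <= Yk k w)%E.
  by rewrite /Yk patchE; case: ifP => // _; have /andP[] := Y0 w.
have mYk k : measurable_fun setT (Yk k).
  by apply/(measurable_restrictT _ _).1 => //; exact: measurable_funTS.
have iYk k : (\int[P]_w Yk k w < +oo)%E.
  apply: (@le_lt_trans _ _ (\int[P]_w (cst k.+1%:R%:E) w)%E).
    apply: ge0_le_integral => // w _; rewrite /Yk patchE; case: ifP => [|_].
      by rewrite inE => /andP[_ /ltW].
    by rewrite lee_fin.
  rewrite integral_cst//.
  by rewrite [X in (_ * X)%E](_ : _ = 1%E) ?mule1 ?ltry//; exact: probability_setT.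
have [W hW] := choice (fun k => cond_exp_nneg_fin (mYk k) (Yk0 k) (iYk k)).
have YE w : Y w = (\sum_(k <oo) Yk k w)%E.
  have /andP[Yw0 Ywoo] := Y0 w.
  have Yfin : Y w \is a fin_num by rewrite ge0_fin_numE.
  pose n := Num.truncn (fine (Y w)).
  have nE k : (w \in A k) = (k == n).
    have y0 : 0 <= fine (Y w) by rewrite fine_ge0.
    apply/idP/eqP => [|->]; rewrite inE /A/= -(fineK Yfin) lee_fin lte_fin /n.
      by move=> h; apply/esym/truncn_def.
    exact: truncn_itv.
  rewrite (@nneseriesD1 _ _ n)//.
  rewrite eseries0 ?adde0; last by move=> k _ /= kn; rewrite /Yk patchE nE (negbTE kn).
  by rewrite /Yk patchE nE eqxx.
exists (fun w => \sum_(k <oo) W k w)%E; split.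
- by move=> w; apply: nneseries_ge0 => k _ _; have [] := hW k.
- apply/measurable_wrtP; apply: ge0_emeasurable_sum => //.
    by move=> k w _ _; have [] := hW k.
  by move=> k _; apply/measurable_wrtP; have [] := hW k.
- move=> E GE; have mE := Gm GE.
  rewrite integral_nneseries//; last 2 first.
  + by move=> k; apply: measurable_funTS; apply: measurable_wrt_fun; have [] := hW k.
  + by move=> k w _; have [] := hW k.
  under [RHS]eq_integral do rewrite YE.
  rewrite integral_nneseries//; last by move=> k; exact: measurable_funTS.
  by apply: eq_eseriesr => k _; have [_ _ ->] := hW k.
Qed.

Import HBNNSimple.

(** Equality of integrals over [G]-sets extends to [G]-simple weights; [xi] is an increasing limit
    of such weights and monotone convergence concludes. *)
Lemma ge0_integral_mul_eq (Y1 Y2 : T -> \bar R) (xi : T -> R) :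
  measurable_fun setT Y1 -> measurable_fun setT Y2 ->
  (forall w, 0 <= Y1 w)%E -> (forall w, 0 <= Y2 w)%E ->
  (forall E, G E -> \int[P]_(w in E) Y1 w = \int[P]_(w in E) Y2 w)%E ->
  measurable_wrt G xi -> (forall w, 0 <= xi w) ->
  (\int[P]_w ((xi w)%:E * Y1 w) = \int[P]_w ((xi w)%:E * Y2 w))%E.
Proof.
move=> mY1 mY2 Y10 Y20 Y12 mxi xi0.
have mxi' : measurable_fun [set: g_sigma_algebraType G] (EFin \o xi).
  by apply/measurable_EFinP/measurable_wrtP.
pose h := nnsfun_approx measurableT mxi'.
have mh n : measurable_fun [set: T] (h n).
  by apply: measurable_wrt_fun; apply/measurable_wrtP.
have key (Y : T -> \bar R) : measurable_fun setT Y -> (forall w, 0 <= Y w)%E ->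
   (\int[P]_w ((xi w)%:E * Y w) =
    limn (fun n => \sum_(y \in range (h n)) y%:E * \int[P]_(w in h n @^-1` [set y]) Y w))%E.
  move=> mY Y0.
  have cvgh w : ((h n w)%:E * Y w)%E @[n --> \oo] --> ((xi w)%:E * Y w)%E.
    have hxi : (h n w)%:E @[n --> \oo] --> (xi w)%:E.
      apply: (cvg_nnsfun_approx measurableT mxi') => //= x _.
      by rewrite lee_fin.
    have [Yfin|] := boolP (Y w \is a fin_num); first exact: cvgeZr.
    (* Here [Y w] is infinite, and 0 * oo = 0: where [xi w] vanishes so do its approximations from
       below; elsewhere they are eventually positive and the product is +oo. *)
    rewrite ge0_fin_numE// -leNgt leye_eq => /eqP ->.
    have [xiw0|xiw0] := leP (xi w) 0.
      have xiw : xi w = 0 by apply/eqP; rewrite eq_le xiw0 xi0.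
      rewrite xiw mul0e (_ : (fun n => _) = cst 0%E); first exact: cvg_cst.
      apply/funext => n; apply/eqP; rewrite mule_eq0; apply/orP; left.
      rewrite eqe eq_le -[X in _ <= X]xiw.
      apply/andP; split=> //; rewrite -lee_fin.
      rewrite nnsfun_approxE; apply: le_approx => // x _; rewrite lee_fin.
      exact: xi0.
    rewrite gt0_muley ?lte_fin//.
    apply: cvg_near_cst.
    have : \forall n \near \oo, (0 < (h n w)%:E)%E.
      by move/fine_cvgP: hxi => [_ /cvgr_gt /(_ _ xiw0)]; apply: filterS.
    by apply: filterS => n hn; rewrite gt0_muley.
  transitivity (limn (fun n => \int[P]_w ((h n w)%:E * Y w)))%E.
    rewrite -monotone_convergence//.
    - apply: eq_integral => w _; apply/esym/cvg_lim => //; exact: cvgh.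
    - by move=> n; apply: emeasurable_funM => //; exact/measurable_EFinP.
    - by move=> n w _; rewrite mule_ge0// lee_fin.
    - move=> w _ a b ab; rewrite lee_wpmul2r// lee_fin.
      by have /lefP/(_ w) := @nd_nnsfun_approx _ _ _ _ measurableT _ mxi' a b ab.
  congr (limn _); apply/funext => n.
  have mhn y : measurable ((h n : T -> R) @^-1` [set y]).
    by rewrite -[X in measurable X]setTI; exact: mh.
  transitivity (\int[P]_w (\sum_(y \in range (h n))
      (y * \1_(h n @^-1` [set y]) w)%:E * Y w))%E.
    apply: eq_integral => w _.
    rewrite -ge0_mule_fsuml => [|y]; last exact: nnfun_muleindic_ge0.
    by rewrite fsumEFin//; congr (_%:E * _)%E; exact: fimfunE.
  rewrite ge0_integral_fsum//; last 2 first.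
  - move=> y; apply: emeasurable_funM => //; apply/measurable_EFinP.
    exact: measurable_funM.
  - by move=> y w _; rewrite mule_ge0// nnfun_muleindic_ge0.
  apply: eq_fsbigr => y; rewrite inE => -[t _ <-].
  under eq_integral do rewrite EFinM -muleA.
  rewrite ge0_integralZl//; last 3 first.
  - by apply: emeasurable_funM => //; exact/measurable_EFinP.
  - by move=> w _; rewrite mule_ge0// lee_fin.
  - by rewrite lee_fin.
  congr (_ * _)%E.
  under eq_integral do rewrite muleC.
  rewrite [RHS]integral_mkcond; apply: eq_integral => w _.
  by rewrite epatch_indic.
rewrite !key//; congr (limn _); apply/funext => n.
apply: eq_fsbigr => y _; rewrite Y12//.
apply/measurable_wrt_setP.
exact: measurable_funPTI.
Qed.


Lemma EFin_mul_funepos (x y : R) : 0 <= x ->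
  (x%:E * maxe y%:E 0 = maxe (x * y)%:E 0)%E.
Proof. by move=> x0; rewrite -!EFin_max -EFinM maxr_pMr// mulr0. Qed.

(** A nonnegative factor passes through positive and negative parts, so it can be treated on [U] and
    [V] separately. Integrability is that of [xi * Y]: it yields that of [xi * U] and [xi * V],
    while [U] and [V] themselves may have infinite integrals. *)
Lemma cond_exp_mul_ge0 (Y W xi : T -> R) :
  measurable_fun [set: T] Y -> measurable_fun [set: T] W ->
  is_cond_exp P G (EFin \o Y) (EFin \o W) ->
  measurable_wrt G xi -> (forall w, 0 <= xi w) ->
  P.-integrable [set: T] (EFin \o (fun w => xi w * Y w)) ->
  P.-integrable [set: T] (EFin \o (fun w => xi w * W w)) /\
  (\int[P]_w (xi w * W w)%:E = \int[P]_w (xi w * Y w)%:E)%E.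
Proof.
move=> mY mW [U [V [[U0 mU UE] [V0 mV VE] _ WE]]] mxi xi0 ixiY.
have mxiT := measurable_wrt_fun mxi.
have mUT := measurable_wrt_fun mU.
have mVT := measurable_wrt_fun mV.
have mEY : measurable_fun [set: T] (EFin \o Y) by exact/measurable_EFinP.
have mEx : measurable_fun [set: T] (EFin \o xi) by exact/measurable_EFinP.
have EU : (\int[P]_w ((xi w)%:E * U w) = \int[P]_w ((EFin \o (fun w => xi w * Y w)%R)^\+ w))%E.
  rewrite (@ge0_integral_mul_eq U ((EFin \o Y)^\+)%E)//.
  - by apply: eq_integral => w _; rewrite !funeposE/= EFin_mul_funepos.
  - exact: measurable_funepos.
have EV : (\int[P]_w ((xi w)%:E * V w) = \int[P]_w ((EFin \o (fun w => xi w * Y w)%R)^\- w))%E.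
  rewrite (@ge0_integral_mul_eq V ((EFin \o Y)^\-)%E)//.
  - by apply: eq_integral => w _; rewrite !funenegE/= EFin_mul_funepos// mulrN.
  - exact: measurable_funeneg.
have intM H : measurable_fun setT H -> (forall w, 0 <= H w)%E ->
    (\int[P]_w ((xi w)%:E * H w) < +oo)%E ->
    P.-integrable [set: T] (fun w => (xi w)%:E * H w)%E.
  move=> mH H0 iH; apply/integrableP; split; first exact: emeasurable_funM.
  by under eq_integral do rewrite gee0_abs ?mule_ge0 ?lee_fin//.
have iU : P.-integrable [set: T] (fun w => (xi w)%:E * U w)%E.
  by apply: intM => //; rewrite EU; exact: integral_funepos_lt_pinfty.
have iV : P.-integrable [set: T] (fun w => (xi w)%:E * V w)%E.
  by apply: intM => //; rewrite EV; exact: integral_funeneg_lt_pinfty.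
have iB := integrableB measurableT iU iV.
have aeE : ae_eq P [set: T] (EFin \o (fun w => xi w * W w))
    (fun w => (xi w)%:E * U w - (xi w)%:E * V w)%E.
  apply: filterS WE => w /= + _; rewrite EFinM => WE.
  have UVfin : (U w - V w)%E \is a fin_num by rewrite -WE.
  rewrite WE muleBr// fin_num_adde_defr//.
  by move: UVfin; rewrite fin_numB => /andP[].
have mxiW : measurable_fun [set: T] (EFin \o (fun w => xi w * W w)).
  by apply/measurable_EFinP; exact: measurable_funM.
split.
  apply/integrableP; split => //.
  have /integrableP[mB] := iB; apply: le_lt_trans.
  rewrite le_eqVlt; apply/orP; left; apply/eqP; apply: ge0_ae_eq_integral => //.
  - exact: measurableT_comp.
  - exact: measurableT_comp.
  - exact: ae_eq_abse.
transitivity (\int[P]_w ((xi w)%:E * U w - (xi w)%:E * V w))%E.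
  by apply: ae_eq_integral => //; exact: measurable_int iB.
by rewrite integralB// EU EV -integralE.
Qed.

Lemma cond_exp_mul (Y W xi : T -> R) :
  measurable_fun [set: T] Y -> measurable_fun [set: T] W ->
  is_cond_exp P G (EFin \o Y) (EFin \o W) ->
  measurable_wrt G xi ->
  P.-integrable [set: T] (EFin \o (fun w => xi w * Y w)) ->
  P.-integrable [set: T] (EFin \o (fun w => xi w * W w)) /\
  \int[P]_w (xi w * W w) = \int[P]_w (xi w * Y w).
Proof.
move=> mY mW hW mxi ixiY.
have mxiT := measurable_wrt_fun mxi.
have iabs (f : T -> R) : measurable_fun [set: T] f -> (forall w, `|f w| <= `|xi w|) ->
    P.-integrable [set: T] (EFin \o (fun w => f w * Y w)).
  move=> mf fxi; apply: (le_integrable measurableT _ _ ixiY).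
    by apply/measurable_EFinP; exact: measurable_funM.
  by move=> w _ /=; rewrite lee_fin !normrM ler_wpM2r.
have pos_le w : `|xi^\+ w| <= `|xi w|.
  by rewrite /funrpos/=; have [xi0|xi0] := leP (xi w) 0; rewrite ?normr0.
have neg_le w : `|xi^\- w| <= `|xi w|.
  by rewrite /funrneg/=; have [xi0|xi0] := leP (- xi w) 0; rewrite ?normr0// normrN.
have ip := iabs _ (measurable_funrpos mxiT) pos_le.
have iN := iabs _ (measurable_funrneg mxiT) neg_le.
have [|//|iWp Ep] := cond_exp_mul_ge0 mY mW hW _ _ ip.
  by apply/measurable_wrtP; apply: measurable_funrpos; exact/measurable_wrtP.
have [|//|iWn En] := cond_exp_mul_ge0 mY mW hW _ _ iN.
  by apply/measurable_wrtP; apply: measurable_funrneg; exact/measurable_wrtP.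
have split_xi (f : T -> R) : (fun w => xi w * f w) = (fun w => xi^\+ w * f w - xi^\- w * f w).
  by apply/funext => w; rewrite -mulrBl -[in LHS](funrposBneg xi).
split; first by rewrite split_xi; exact: (integrableB measurableT iWp iWn).
rewrite !split_xi !RintegralB//.
by rewrite /Rintegral Ep En.
Qed.


(** The positive function [g - f] has zero integral over [E]. *)
Lemma ge0_integral_le_lt_null (E : set T) (f g : T -> \bar R) :
  measurable E -> measurable_fun E f -> measurable_fun E g ->
  (forall w, 0 <= f w)%E -> (forall w, E w -> f w < g w)%E ->
  (\int[P]_(w in E) g w < +oo)%E ->
  (\int[P]_(w in E) g w <= \int[P]_(w in E) f w)%E -> P E = 0.
Proof.
move=> mE mf mg f0 fg ig gf.
have g0 w : E w -> (0 <= g w)%E by move=> Ew; rewrite (le_trans (f0 w))// ltW// fg.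
have intg : P.-integrable E g.
  apply/integrableP; split => //.
  by under eq_integral => w /set_mem Ew do rewrite gee0_abs ?g0//.
have intf : P.-integrable E f.
  apply: le_integrable intg => // w Ew.
  by rewrite !gee0_abs ?g0// ltW// fg.
have : (\int[P]_(w in E) `|(g \- f) w|)%E = 0.
  transitivity (\int[P]_(w in E) (g \- f) w)%E.
    apply: eq_integral => w /set_mem Ew; rewrite gee0_abs//= sube_ge0 ?ltW ?fg//.
    by apply/orP; left; rewrite ge0_fin_numE// (lt_le_trans (fg _ Ew))// leey.
  rewrite integralB//; apply/eqP; rewrite eq_le; apply/andP; split.
    by rewrite sube_le0.
  rewrite sube_ge0 ?integrable_fin_num ?orbT//.
  by apply: ge0_le_integral => // w Ew; rewrite ltW// fg.
move/(ae_eq_integral_abs P mE (emeasurable_funB mg mf)) => [N [mN PN0 subN]].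
apply/eqP; rewrite eq_le measure_ge0 andbT -PN0 le_measure ?inE// => w Ew.
apply: subN => /= /(_ Ew)/=; apply/eqP; rewrite gt_eqF// sube_gt0 fg//.
Qed.

(** With [U] and [V] the conditional expectations of Z1^+ and Z1^-, the inequality is first proved
    in the subtraction-free form V + Z0^+ <= U + Z0^-, since [U] may be infinite. It is tested on
    the [G]-set where it fails, and the hypothesis on the [B m] shows that this set is null. *)
Lemma cond_exp_ge (Z0 Z1 : T -> R) (B : nat -> set T) :
  measurable_wrt G Z0 -> measurable_fun [set: T] Z1 ->
  (forall m, G (B m)) -> (forall w, exists m, B m w) ->
  (forall m E, G E -> E `<=` B m ->
     (\int[P]_(w in E) (Num.max (Z0 w - Z1 w) 0)%:E < +oo)%E /\
     (\int[P]_(w in E) (Num.max (Z0 w - Z1 w) 0)%:E <=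
      \int[P]_(w in E) (Num.max (Z1 w - Z0 w) 0)%:E)%E) ->
  exists W, is_cond_exp P G (EFin \o Z1) W /\ {ae P, forall w, ((Z0 w)%:E <= W w)%E}.
Proof.
move=> mZ0 mZ1 GB covB hB.
have mZ0T := measurable_wrt_fun mZ0.
have mEZ1 : measurable_fun [set: T] (EFin \o Z1) by exact/measurable_EFinP.
have mpos (f : T -> R) : measurable_fun setT f ->
    measurable_fun [set: T] (fun w => (Num.max (f w) 0)%:E).
  by move=> mf; apply/measurable_EFinP; exact: measurable_maxr.
have pos0 (x : R) : (0 <= (Num.max x 0)%:E)%E by rewrite lee_fin le_max lexx orbT.
have [U [U0 mU UE]] : exists U, is_cond_exp_nneg P G ((EFin \o Z1)^\+)%E U.
  apply: cond_exp_nneg_exists; first exact: measurable_funepos.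
  by move=> w; rewrite funepos_ge0 funeposE/= -EFin_max ltry.
have [V [V0 mV VE]] : exists V, is_cond_exp_nneg P G ((EFin \o Z1)^\-)%E V.
  apply: cond_exp_nneg_exists; first exact: measurable_funeneg.
  by move=> w; rewrite funeneg_ge0 funenegE/= -EFin_max ltry.
have mUT := measurable_wrt_fun mU.
have mVT := measurable_wrt_fun mV.
have {}UE E : G E -> (\int[P]_(w in E) U w = \int[P]_(w in E) (Num.max (Z1 w) 0)%:E)%E.
  by move=> GE; rewrite UE//; apply: eq_integral => w _; rewrite funeposE/= EFin_max.
have {}VE E : G E -> (\int[P]_(w in E) V w = \int[P]_(w in E) (Num.max (- Z1 w) 0)%:E)%E.
  by move=> GE; rewrite VE//; apply: eq_integral => w _; rewrite funenegE/= EFin_max.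
have GI E1 E2 : G E1 -> G E2 -> G (E1 `&` E2).
  move=> /measurable_wrt_setP h1 /measurable_wrt_setP h2.
  by apply/measurable_wrt_setP; exact: measurableI.
(* Bounding [Z0] makes [V] integrable on each piece: Z1^- <= Z0^- + (Z0 - Z1)^+, and the last term
   has a finite integral there by hypothesis. *)
pose E0 m k := B m `&` [set w | `|Z0 w| <= k%:R].
have GE0 m k : G (E0 m k).
  apply: GI => //.
  rewrite (_ : [set _ | _] = (Num.norm \o Z0) @^-1` `]-oo, k%:R]); last first.
    by apply/seteqP; split=> w /=; rewrite in_itv.
  have : measurable_wrt G (Num.norm \o Z0).
    apply/measurable_wrtP; apply: measurableT_comp => //; exact/measurable_wrtP.
  by apply.
have loc m k : {ae P, forall w, E0 m k w ->
    ((V w < +oo) /\ (V w + (Num.max (Z0 w) 0)%:E <= U w + (Num.max (- Z0 w) 0)%:E))%E}.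
  have mE0 := Gm (GE0 m k).
  have [iD _] := hB m (E0 m k) (GE0 m k) (@subIsetl _ _ _).
  have bnd (f : T -> R) : measurable_fun setT f -> (forall w, E0 m k w -> f w <= k%:R) ->
      (\int[P]_(w in E0 m k) (Num.max (f w) 0)%:E < +oo)%E.
    move=> mf fk; apply: (@le_lt_trans _ _ (\int[P]_(w in E0 m k) (cst k%:R%:E w))%E).
      apply: ge0_le_integral => //.
      - by apply: measurable_funTS; exact: mpos.
      - by move=> w Ew; rewrite lee_fin ge_max fk//=.
    rewrite integral_cst// lte_mul_pinfty// ?lee_fin//.
    by apply: le_lt_trans (probability_le1 P mE0) _; rewrite ltry.
  have iV : (\int[P]_(w in E0 m k) V w < +oo)%E.
    rewrite VE//.
    apply: (@le_lt_trans _ _ (\int[P]_(w in E0 m k)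
        ((Num.max (- Z0 w) 0)%:E + (Num.max (Z0 w - Z1 w) 0)%:E))%E).
      apply: ge0_le_integral => //.
      - by apply: measurable_funTS; apply: mpos; exact: measurable_funN.
      - apply: measurable_funTS; apply: emeasurable_funD; apply: mpos.
          exact: measurable_funN.
        exact: measurable_funB.
      - move=> w _; rewrite -EFinD lee_fin.
        by max_lra.
    rewrite ge0_integralD//; last 2 first.
    - by apply: measurable_funTS; apply: mpos; exact: measurable_funN.
    - by apply: measurable_funTS; apply: mpos; exact: measurable_funB.
    apply: lte_add_pinfty => //; apply: bnd; first exact: measurable_funN.
    by move=> w [_ /=]; rewrite ler_norml => /andP[]; rewrite lerNl.
  have aeV : {ae P, forall w, E0 m k w -> V w \is a fin_num}.
    apply: integrable_ae => //; apply/integrableP; split; first exact: measurable_funTS.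
    by under eq_integral do rewrite gee0_abs//.
  pose f w := (U w + (Num.max (- Z0 w) 0)%:E)%E.
  pose g w := (V w + (Num.max (Z0 w) 0)%:E)%E.
  have mposG (h : T -> R) : measurable_wrt G h -> measurable_wrt G (fun w => (Num.max (h w) 0)%:E).
    move=> mh; apply/measurable_wrtP/measurable_EFinP; apply: measurable_maxr => //.
    exact/measurable_wrtP.
  have mf : measurable_wrt G f.
    apply/measurable_wrtP; apply: emeasurable_funD; apply/measurable_wrtP => //.
    by apply: mposG; apply/measurable_wrtP; apply: measurable_funN; exact/measurable_wrtP.
  have mg : measurable_wrt G g.
    by apply/measurable_wrtP; apply: emeasurable_funD; apply/measurable_wrtP => //; exact: mposG.
  pose E := E0 m k `&` [set w | (f w < g w)%E].
  have GE : G E.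
    apply: GI => //; apply/measurable_wrt_setP.
    rewrite -[X in measurable X]setTI; apply: measurable_lte => //; exact/measurable_wrtP.
  have mE := Gm GE.
  have PE0 : P E = 0.
    have mZ0n := measurable_funN mZ0T.
    have mZ1n := measurable_funN mZ1.
    have m01 := measurable_funB mZ0T mZ1.
    have m10 := measurable_funB mZ1 mZ0T.
    have sub_fin h : (forall w, 0 <= h w)%E -> measurable_fun setT h ->
      (\int[P]_(w in E0 m k) h w < +oo)%E -> (\int[P]_(w in E) h w < +oo)%E.
      move=> h0 mh; apply: le_lt_trans; apply: ge0_subset_integral => //.
        exact: measurable_funTS.
      exact: subIsetl.
    have [iDE DE] := hB m E GE (fun w Ew => (Ew.1).1).
    have igE : (\int[P]_(w in E) g w = \int[P]_(w in E) (Num.max (- Z1 w) 0)%:E +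
        \int[P]_(w in E) (Num.max (Z0 w) 0)%:E)%E.
      rewrite ge0_integralD//; [by rewrite VE|exact: measurable_funTS|].
      by apply: measurable_funTS; exact: mpos.
    have ifE : (\int[P]_(w in E) f w = \int[P]_(w in E) (Num.max (Z1 w) 0)%:E +
        \int[P]_(w in E) (Num.max (- Z0 w) 0)%:E)%E.
      rewrite ge0_integralD//; [by rewrite UE|exact: measurable_funTS|].
      by apply: measurable_funTS; exact: mpos.
    apply: (@ge0_integral_le_lt_null E f g) => //.
    - by apply: measurable_funTS; exact: measurable_wrt_fun.
    - by apply: measurable_funTS; exact: measurable_wrt_fun.
    - by move=> w; rewrite adde_ge0.
    - by move=> w [].
    - rewrite igE -VE//; apply: lte_add_pinfty; first exact: sub_fin.
      apply: sub_fin; [by move=> w; exact: pos0|exact: mpos|].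
      by apply: bnd => // w [_ /=]; exact/le_trans/ler_norm.
    - have iDfin : (\int[P]_(w in E) (Num.max (Z0 w - Z1 w) 0)%:E)%E \is a fin_num.
        by rewrite ge0_fin_numE//; apply: integral_ge0.
      (* Adding the finite integral of (Z0 - Z1)^+ to both sides reduces the claim to the
         hypothesis, through Z1^+ + Z0^- + (Z0 - Z1)^+ = Z1^- + Z0^+ + (Z1 - Z0)^+. *)
      rewrite -(leeD2rE _ _ iDfin) igE ifE.
      have int3 (f1 f2 f3 : T -> R) : measurable_fun setT f1 ->
          measurable_fun setT f2 -> measurable_fun setT f3 ->
          (\int[P]_(w in E) (Num.max (f1 w) 0)%:E +
           \int[P]_(w in E) (Num.max (f2 w) 0)%:E +
           \int[P]_(w in E) (Num.max (f3 w) 0)%:E =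
           \int[P]_(w in E) (Num.max (f1 w) 0 + Num.max (f2 w) 0 +
                             Num.max (f3 w) 0)%:E)%E.
        move=> m1 m2 m3.
        rewrite -ge0_integralD//; [|exact/measurable_funTS/mpos..].
        rewrite -ge0_integralD//; last exact/measurable_funTS/mpos.
          by move=> w _; rewrite adde_ge0.
        by apply: measurable_funTS; apply: emeasurable_funD; exact: mpos.
      rewrite int3// [leRHS](_ : _ = \int[P]_(w in E) (Num.max (- Z1 w) 0)%:E +
          \int[P]_(w in E) (Num.max (Z0 w) 0)%:E +
          \int[P]_(w in E) (Num.max (Z1 w - Z0 w) 0)%:E)%E; last first.
        rewrite !int3//; apply: eq_integral => w _; congr EFin.
        have := (maxrN0 (Z1 w), maxrN0 (Z0 w), maxrN0 (Z1 w - Z0 w)).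
        by rewrite opprB => -[[]]; lra.
      rewrite -int3//.
      exact: leeD2l.
  have aeE : {ae P, forall w, ~ E w}.
    by exists E; split => // w /= /contrapT.
  apply: filterS2 aeV aeE => w Vfin nE Ew; split.
    by have := Vfin Ew; rewrite ge0_fin_numE.
  by rewrite leNgt; apply/negP => fg; apply: nE.
exists (fun w => U w - V w)%E.
have locall : {ae P, forall w,
    ((V w < +oo) /\ (V w + (Num.max (Z0 w) 0)%:E <= U w + (Num.max (- Z0 w) 0)%:E))%E}.
  have : {ae P, forall w m k, E0 m k w ->
    ((V w < +oo) /\ (V w + (Num.max (Z0 w) 0)%:E <= U w + (Num.max (- Z0 w) 0)%:E))%E}.
    apply: ae_foralln => m; apply: ae_foralln => k; exact: loc.
  apply: filterS => w hw; have [m Bmw] := covB w.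
  apply: (hw m (Num.truncn `|Z0 w|).+1); split => //=.
  by rewrite ltW// truncnS_gt.
split.
  exists U, V; split => //.
  - by split => // E GE; rewrite UE//; apply: eq_integral => w _; rewrite funeposE/= EFin_max.
  - by split => // E GE; rewrite VE//; apply: eq_integral => w _; rewrite funenegE/= EFin_max.
  - by apply: filterS locall => w [+ _]; right.
  - exact: aeW.
apply: filterS locall => w [Voo].
have Vfin : V w \is a fin_num by rewrite ge0_fin_numE.
rewrite leeBrDr// -(fineK Vfin).
have [Ufin|] := boolP (U w \is a fin_num); last first.
  by rewrite ge0_fin_numE// -leNgt leye_eq => /eqP -> _; rewrite leey.
rewrite -(fineK Ufin) -!EFinD !lee_fin.
by max_lra.
Qed.

End SubSigmaAlgebra.

(** * Martingale transforms *)

Section SquareIntegrable.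
Context {d : measure_display} {T : measurableType d} {R : realType}.
Variable P : probability T R.
Implicit Types f g : T -> R.

Definition sq_int f := measurable_fun [set: T] f /\
  P.-integrable [set: T] (EFin \o (fun w => f w ^+ 2)).

Lemma le_integrable_real f g : measurable_fun [set: T] f ->
  (forall w, `|f w| <= g w) ->
  P.-integrable [set: T] (EFin \o g) -> P.-integrable [set: T] (EFin \o f).
Proof.
move=> mf fg; apply: le_integrable => //; first exact/measurable_EFinP.
move=> w _ /=; rewrite lee_fin (le_trans (fg w))// ler_norm//.
Qed.

Lemma integrable_realD f g :
  P.-integrable [set: T] (EFin \o f) -> P.-integrable [set: T] (EFin \o g) ->
  P.-integrable [set: T] (EFin \o (fun w => f w + g w)).
Proof. by move=> hf hg; exact: (integrableD measurableT hf hg). Qed.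

Lemma integrable_realB f g :
  P.-integrable [set: T] (EFin \o f) -> P.-integrable [set: T] (EFin \o g) ->
  P.-integrable [set: T] (EFin \o (fun w => f w - g w)).
Proof. by move=> hf hg; exact: (integrableB measurableT hf hg). Qed.

Lemma integrable_realZ (r : R) f :
  P.-integrable [set: T] (EFin \o f) ->
  P.-integrable [set: T] (EFin \o (fun w => r * f w)).
Proof. by move=> hf; exact: (integrableZl measurableT r hf). Qed.

Lemma integrable_real_sum n (f : nat -> T -> R) :
  (forall i, (i < n)%N -> P.-integrable [set: T] (EFin \o f i)) ->
  P.-integrable [set: T] (EFin \o (fun w => \sum_(i < n) f i w)).
Proof.
elim: n => [_|n IH hf].
  apply: eq_integrable (integrable0 P [set: T]) => //= w _.
  by rewrite /= big_ord0.
have h1 := IH (fun i hi => hf i (ltnW hi)).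
apply: eq_integrable (integrable_realD h1 (hf n (ltnSn n))) => //= w _.
by rewrite /= big_ord_recr.
Qed.

Lemma Rintegral_sum n (f : nat -> T -> R) :
  (forall i, (i < n)%N -> P.-integrable [set: T] (EFin \o f i)) ->
  \int[P]_w (\sum_(i < n) f i w) = \sum_(i < n) \int[P]_w f i w.
Proof.
elim: n => [_|n IH hf].
  by under eq_Rintegral do rewrite big_ord0; rewrite Rintegral_cst// mul0r big_ord0.
under eq_Rintegral do rewrite big_ord_recr/=.
rewrite big_ord_recr/= RintegralD//; last exact: hf.
  by rewrite IH// => i hi; apply: hf; exact: ltnW.
by apply: integrable_real_sum => i hi; apply: hf; exact: ltnW.
Qed.

Lemma integrable_real_meas f : P.-integrable [set: T] (EFin \o f) ->
  measurable_fun [set: T] f.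
Proof. by move=> /measurable_int/measurable_EFinP. Qed.

Lemma sq_int_mul f g : sq_int f -> sq_int g ->
  P.-integrable [set: T] (EFin \o (fun w => f w * g w)).
Proof.
move=> [mf hf] [mg hg]; apply: le_integrable_real (integrable_realD hf hg).
  exact: measurable_funM.
move=> w; rewrite ler_norml; have := sqr_ge0 (f w + g w); have := sqr_ge0 (f w - g w).
have := sqr_ge0 (f w); have := sqr_ge0 (g w).
by rewrite sqrrB sqrrD !mulr2n => *; apply/andP; split; lra.
Qed.

Lemma sq_int_cst (r : R) : sq_int (cst r).
Proof. by split=> //; exact: (finite_measure_integrable_cst P (r ^+ 2) measurableT). Qed.

Lemma sq_intD f g : sq_int f -> sq_int g -> sq_int (fun w => f w + g w).
Proof.
move=> hf hg; have fg := sq_int_mul hf hg; case: hf hg => mf hf [mg hg].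
split; first exact: measurable_funD.
apply: eq_integrable (integrable_realD (integrable_realD hf (integrable_realZ 2 fg)) hg) => //= w _.
by rewrite /= sqrrD mulr2n mulrDl mul1r.
Qed.

Lemma sq_intN f : sq_int f -> sq_int (fun w => - f w).
Proof.
move=> [mf hf]; split; first exact: measurable_funN.
by apply: eq_integrable hf => //= w _; rewrite /= sqrrN.
Qed.

Lemma sq_intB f g : sq_int f -> sq_int g -> sq_int (fun w => f w - g w).
Proof. by move=> hf /sq_intN; exact: sq_intD. Qed.

Lemma sq_int_integrable f : sq_int f -> P.-integrable [set: T] (EFin \o f).
Proof.
move=> hf; apply: eq_integrable (sq_int_mul hf (sq_int_cst 1)) => //= w _.
by rewrite /= mulr1.
Qed.

Lemma sq_int_bounded_mul (C : R) f g : measurable_fun [set: T] f ->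
  (forall w, `|f w| <= C) -> sq_int g -> sq_int (fun w => f w * g w).
Proof.
move=> mf fC [mg hg]; split; first exact: measurable_funM.
apply: le_integrable_real (integrable_realZ (C ^+ 2) hg).
  by apply: measurable_funX; exact: measurable_funM.
move=> w; rewrite ger0_norm ?sqr_ge0// exprMn ler_wpM2r ?sqr_ge0//.
by rewrite -real_normK ?num_real// lerXn2r ?nnegrE// (le_trans _ (fC w)).
Qed.

Lemma integrable_bounded_mul (C : R) f g : measurable_fun [set: T] f ->
  (forall w, `|f w| <= C) -> P.-integrable [set: T] (EFin \o g) ->
  P.-integrable [set: T] (EFin \o (fun w => f w * g w)).
Proof.
move=> mf fC hg; apply: le_integrable_real (integrable_realZ C (integrable_norm hg)).
  by apply: measurable_funM => //; exact: integrable_real_meas.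
by move=> w; rewrite normrM /= ler_wpM2r.
Qed.

End SquareIntegrable.

Section MartingaleTransform.
Context {d : measure_display} {T : measurableType d} {R : realType}.
Variables (P : probability T R) (F : R -> set (set T)) (M Q : R -> T -> R).
Hypothesis hF : filtration F.
Hypotheses (hM : martingale P 0 F M) (hM2 : square_integrable P M).
Hypothesis iQ : integrable_process P 0 Q.
Hypothesis hMQ : martingale P 0 F (fun t w => (M t w) ^+ 2 - Q t w).

Lemma filtration_sigma t : 0 <= t -> sigma_algebra [set: T] (F t).
Proof. by move=> t0; have [/(_ t t0)[]] := hF. Qed.

Lemma filtration_measurable t : 0 <= t -> F t `<=` d.-measurable.
Proof. by move=> t0; have [/(_ t t0)[]] := hF. Qed.

Lemma filtration_fun d' (U : measurableType d') t (f : T -> U) : 0 <= t ->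
  measurable_wrt (F t) f -> measurable_fun [set: T] f.
Proof. by move=> t0; apply: measurable_wrt_fun; exact: filtration_measurable. Qed.

Lemma filtration_le d' (U : measurableType d') s t (f : T -> U) :
  0 <= s -> s <= t -> measurable_wrt (F s) f -> measurable_wrt (F t) f.
Proof. by move=> s0 st mf B mB; have [_ h] := hF; apply: (h s t s0 st); exact: mf. Qed.

Lemma measurable_wrt_sub t (f g : T -> R) : 0 <= t ->
  measurable_wrt (F t) f -> measurable_wrt (F t) g ->
  measurable_wrt (F t) (fun w => f w - g w).
Proof.
move=> t0 mf mg; have sF := filtration_sigma t0.
by apply/(measurable_wrtP sF)/measurable_funB; apply/(measurable_wrtP sF).
Qed.

Lemma measurable_wrt_add t (f g : T -> R) : 0 <= t ->
  measurable_wrt (F t) f -> measurable_wrt (F t) g ->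
  measurable_wrt (F t) (fun w => f w + g w).
Proof.
move=> t0 mf mg; have sF := filtration_sigma t0.
by apply/(measurable_wrtP sF)/measurable_funD; apply/(measurable_wrtP sF).
Qed.

Lemma measurable_wrt_mul t (f g : T -> R) : 0 <= t ->
  measurable_wrt (F t) f -> measurable_wrt (F t) g ->
  measurable_wrt (F t) (fun w => f w * g w).
Proof.
move=> t0 mf mg; have sF := filtration_sigma t0.
by apply/(measurable_wrtP sF)/measurable_funM; apply/(measurable_wrtP sF).
Qed.

Lemma mart_adapted t : 0 <= t -> measurable_wrt (F t) (M t).
Proof. by move=> t0; have [_ h _] := hM; exact: h. Qed.

Lemma mart_sq_int t : 0 <= t -> sq_int P (M t).
Proof.
by move=> t0; split; [exact: (filtration_fun t0 (mart_adapted t0))|exact: hM2].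
Qed.

Lemma martingale_mul (N : R -> T -> R) (s t : R) (xi : T -> R) :
  martingale P 0 F N -> 0 <= s -> s <= t -> measurable_wrt (F s) xi ->
  P.-integrable [set: T] (EFin \o (fun w => xi w * N t w)) ->
  P.-integrable [set: T] (EFin \o (fun w => xi w * N s w)) /\
  \int[P]_w (xi w * N s w) = \int[P]_w (xi w * N t w).
Proof.
move=> [iN aN hN] s0 st mxi ixi; have t0 := le_trans s0 st.
apply: (cond_exp_mul (filtration_sigma s0) (filtration_measurable s0)) => //.
- exact: (filtration_fun t0 (aN _ t0)).
- exact: (filtration_fun s0 (aN _ s0)).
- exact: hN.
Qed.

Lemma mart_increment_orth (s t : R) (xi : T -> R) :
  0 <= s -> s <= t -> measurable_wrt (F s) xi -> sq_int P xi ->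
  P.-integrable [set: T] (EFin \o (fun w => xi w * (M t w - M s w))) /\
  \int[P]_w (xi w * (M t w - M s w)) = 0.
Proof.
move=> s0 st mxi hxi; have t0 := le_trans s0 st.
have it := sq_int_mul hxi (mart_sq_int t0).
have ims := sq_int_mul hxi (mart_sq_int s0).
have [_ E] := martingale_mul hM s0 st mxi it.
split; first exact: sq_int_mul hxi (sq_intB (mart_sq_int t0) (mart_sq_int s0)).
under eq_Rintegral do rewrite mulrBr.
by rewrite RintegralB// E subrr.
Qed.

(** One step of the Ito isometry, by (M_t - M_s)^2 = (M_t^2 - Q_t) - (M_s^2 - Q_s) + (Q_t - Q_s) - 2
    M_s (M_t - M_s). Weighted by c^2, the first two terms cancel in mean because M^2 - Q is a
    martingale, and the last one is centred. *)
Lemma mart_increment_sq (C s t : R) (c : T -> R) :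
  0 <= s -> s <= t -> measurable_wrt (F s) c -> (forall w, `|c w| <= C) ->
  \int[P]_w ((c w * (M t w - M s w)) ^+ 2) =
  \int[P]_w (c w ^+ 2 * (Q t w - Q s w)).
Proof.
move=> s0 st mc cC; have t0 := le_trans s0 st.
have mcT := filtration_fun s0 mc.
have Ms := mart_sq_int s0; have Mt := mart_sq_int t0.
have mc2 : measurable_wrt (F s) (fun w => c w ^+ 2).
  by move: (measurable_wrt_mul s0 mc mc); rewrite (_ : (fun w => c w * c w) = (fun w => c w ^+ 2)).
have mc2T := filtration_fun s0 mc2.
have c2C w : `|c w ^+ 2| <= C ^+ 2.
  by rewrite normrX lerXn2r ?nnegrE// (le_trans _ (cC w)).
have mxi : measurable_wrt (F s) (fun w => c w ^+ 2 * M s w).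
  exact: measurable_wrt_mul (mart_adapted s0).
have [i1 E1] := mart_increment_orth s0 st mxi (sq_int_bounded_mul mc2T c2C Ms).
have iMQ u : 0 <= u -> P.-integrable [set: T] (EFin \o (fun w => c w ^+ 2 * (M u w ^+ 2 - Q u w))).
  move=> u0; apply: (integrable_bounded_mul mc2T c2C).
  by apply: integrable_realB; [exact: hM2|exact: iQ].
have [i2 E2] := martingale_mul hMQ s0 st mc2 (iMQ _ t0).
have iQQ : P.-integrable [set: T] (EFin \o (fun w => c w ^+ 2 * (Q t w - Q s w))).
  apply: (integrable_bounded_mul mc2T c2C).
  by apply: integrable_realB; exact: iQ.
transitivity (\int[P]_w ((c w ^+ 2 * (M t w ^+ 2 - Q t w) - c w ^+ 2 * (M s w ^+ 2 - Q s w))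
   + c w ^+ 2 * (Q t w - Q s w) - 2 * (c w ^+ 2 * M s w * (M t w - M s w)))).
  by apply: eq_Rintegral => w _; ring.
rewrite RintegralB//; last 2 first.
- by apply: integrable_realD => //; apply: integrable_realB; exact: iMQ.
- exact: integrable_realZ.
rewrite RintegralD//; last by apply: integrable_realB; exact: iMQ.
rewrite RintegralB//; last exact: iMQ.
by rewrite RintegralZl// E1 E2 subrr add0r mulr0 subr0.
Qed.

Variables (tm : nat -> R) (c : nat -> T -> R) (C : R).
Hypotheses (tm0 : forall i, 0 <= tm i) (tmS : forall i, tm i <= tm i.+1).
Hypotheses (mc : forall i, measurable_wrt (F (tm i)) (c i))
           (cC : forall i w, `|c i w| <= C).

(** The discrete stochastic integral against [M]: each [c i] is known at the left endpoint of its
    step. *)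
Definition transform n w := \sum_(i < n) c i w * (M (tm i.+1) w - M (tm i) w).

Lemma transformS n w :
  transform n.+1 w = transform n w + c n w * (M (tm n.+1) w - M (tm n) w).
Proof. by rewrite /transform big_ord_recr. Qed.

Lemma transform_measurable n : measurable_wrt (F (tm n)) (transform n).
Proof.
elim: n => [|n IH].
  rewrite (_ : transform 0 = cst 0); last by apply/funext => w; rewrite /transform big_ord0.
  by apply/(measurable_wrtP (filtration_sigma (tm0 0))).
rewrite (_ : transform n.+1 =
  fun w => transform n w + c n w * (M (tm n.+1) w - M (tm n) w)); last first.
  by apply/funext => w; rewrite transformS.
apply: measurable_wrt_add => //; first exact: filtration_le IH.
apply: measurable_wrt_mul => //; first exact: filtration_le (mc n).
apply: measurable_wrt_sub => //; first exact: mart_adapted.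
exact: filtration_le (mart_adapted (tm0 n)).
Qed.

Lemma increment_sq_int n : sq_int P (fun w => c n w * (M (tm n.+1) w - M (tm n) w)).
Proof.
apply: (@sq_int_bounded_mul _ _ _ _ C) => //; first exact: filtration_fun (mc n).
by apply: sq_intB; exact: mart_sq_int.
Qed.

Lemma transform_sq_int n : sq_int P (transform n).
Proof.
elim: n => [|n IH].
  rewrite (_ : transform 0 = cst 0); last by apply/funext => w; rewrite /transform big_ord0.
  exact: sq_int_cst.
rewrite (_ : transform n.+1 =
  fun w => transform n w + c n w * (M (tm n.+1) w - M (tm n) w)); last first.
  by apply/funext => w; rewrite transformS.
by apply: sq_intD => //; exact: increment_sq_int.
Qed.

(** In the induction, the cross term is the new increment of [M] weighted by a variable known at
    time [tm n], hence centred. *)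
Lemma transform_sq n : \int[P]_w (transform n w ^+ 2) =
  \sum_(i < n) \int[P]_w (c i w ^+ 2 * (Q (tm i.+1) w - Q (tm i) w)).
Proof.
elim: n => [|n IH].
  rewrite big_ord0; under eq_Rintegral do rewrite /transform big_ord0 expr0n/=.
  by rewrite Rintegral_cst// mul0r.
rewrite big_ord_recr/= -IH -(mart_increment_sq (tm0 n) (tmS n) (mc n) (cC n)).
have mcn := filtration_fun (tm0 n) (mc n).
have [_ iI] := transform_sq_int n.
have [_ id] := increment_sq_int n.
have [|ix Ex] := mart_increment_orth (tm0 n) (tmS n)
  (measurable_wrt_mul (tm0 n) (mc n) (transform_measurable n)).
  exact: sq_int_bounded_mul (cC n) (transform_sq_int n).
transitivity (\int[P]_w (transform n w ^+ 2 + (c n w * (M (tm n.+1) w - M (tm n) w)) ^+ 2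
   + 2 * (c n w * transform n w * (M (tm n.+1) w - M (tm n) w)))).
  by apply: eq_Rintegral => w _; rewrite transformS; ring.
rewrite RintegralD//; last 2 first.
- exact: integrable_realD.
- exact: integrable_realZ.
by rewrite RintegralD// RintegralZl// Ex mulr0 addr0.
Qed.

Lemma transform_mean n (xi : T -> R) : measurable_wrt (F (tm 0)) xi ->
  (forall w, `|xi w| <= 1) -> \int[P]_w (xi w * transform n w) = 0.
Proof.
move=> mxi xi1; have mxiT := filtration_fun (tm0 0) mxi.
have mxin m : measurable_wrt (F (tm m)) xi.
  by elim: m => // m; exact: filtration_le.
elim: n => [|n IH].
  under eq_Rintegral do rewrite /transform big_ord0 mulr0.
  by rewrite Rintegral_cst// mul0r.
have xic : sq_int P (fun w => xi w * c n w).
  apply: (sq_int_bounded_mul mxiT xi1).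
  have := sq_int_bounded_mul (filtration_fun (tm0 n) (mc n)) (cC n) (sq_int_cst P 1).
  by rewrite (_ : (fun w => c n w * cst 1 w) = c n)//; apply/funext => w; rewrite mulr1.
have [ix Ex] := mart_increment_orth (tm0 n) (tmS n)
  (measurable_wrt_mul (tm0 n) (mxin n) (mc n)) xic.
transitivity (\int[P]_w (xi w * transform n w + xi w * c n w * (M (tm n.+1) w - M (tm n) w))).
  by apply: eq_Rintegral => w _; rewrite transformS; ring.
rewrite RintegralD// ?IH ?Ex ?addr0//.
exact: integrable_bounded_mul xi1 (sq_int_integrable (transform_sq_int n)).
Qed.

End MartingaleTransform.

(** * The function Phi and running maxima of paths *)

Section PhiTheory.
Context {R : realType}.
Variable phi : R -> R.
Hypotheses (phiC1 : C1_pos phi) (phi_ni : nonincreasing_pos phi).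
Local Notation mu := (@lebesgue_measure R).

Lemma phi_derive_le0 x : 0 < x -> derive1 phi x <= 0.
Proof.
move=> x0; have dphi := (phiC1 x0).1.
apply: limr_le.
  under eq_fun; first (move=> h; rewrite -{2}(scaler1 h); over).
  exact: dphi.
near=> h.
have h0 : h != 0%R by near: h; exact: nbhs_dnbhs_neq.
have hx : `|h| < x by near: h; exact: dnbhs0_lt.
(* Monotonicity of [phi] is available at positive arguments only. *)
have hx0 : 0 < h + x by move: hx; rewrite ltr_norml => /andP[]; lra.
move: h0; rewrite neq_lt => /orP[h0|h0].
- by rewrite nmulr_rle0 ?invr_lt0// subr_ge0; apply: phi_ni => //; lra.
- by rewrite pmulr_rle0 ?invr_gt0// subr_le0; apply: phi_ni => //; lra.
Unshelve. all: by end_near. Qed.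

Lemma phi_derive_within (a b : R) : 0 < a -> {within `[a, b], continuous (derive1 phi)}.
Proof.
move=> a0; apply: continuous_in_subspaceT => x /set_mem /=; rewrite in_itv/= => /andP[ax _].
exact: (phiC1 (lt_le_trans a0 ax)).2.
Qed.

Lemma phi_continuous x : 0 < x -> {for x, continuous phi}.
Proof.
move=> x0; apply/differentiable_continuous; rewrite -derivable1_diffP.
exact: (phiC1 x0).1.
Qed.

Lemma phi_derive_integrable (a b : R) : 0 < a ->
  mu.-integrable `[a, b] (EFin \o (derive1 phi)).
Proof.
move=> a0; apply: continuous_compact_integrable; first exact: segment_compact.
exact: phi_derive_within.
Qed.

Lemma id_phi_derive_integrable (a b : R) : 0 < a ->
  mu.-integrable `[a, b] (EFin \o (fun y => y * derive1 phi y)).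
Proof.
move=> a0; apply: continuous_compact_integrable; first exact: segment_compact.
apply: continuous_in_subspaceT => x /set_mem /=; rewrite in_itv/= => /andP[ax _].
apply: continuousM; first exact: cvg_id.
exact: (phiC1 (lt_le_trans a0 ax)).2.
Qed.

Lemma phi_FTC (a b : R) : 0 < a -> a < b ->
  \int[mu]_(y in `[a, b]) derive1 phi y = phi b - phi a.
Proof.
move=> a0 ab; rewrite /Rintegral.
rewrite (@continuous_FTC2 R (derive1 phi) phi a b ab (@phi_derive_within a b a0))//.
split.
- by move=> x; rewrite in_itv/= => /andP[ax _]; exact: (phiC1 (lt_trans a0 ax)).1.
- by apply: cvg_at_right_filter; exact: phi_continuous.
- by apply: cvg_at_left_filter; apply: phi_continuous; exact: lt_trans ab.
Qed.

(** On [z, x] the weight y is at least z and -phi' is nonnegative; the fundamental theorem of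
    calculus evaluates what remains. *)
Lemma Phi_ge (x z : R) : 0 < z -> z <= x -> z * (phi z - phi x) <= Phi phi x z.
Proof.
move=> z0; rewrite le_eqVlt => /predU1P[<-|zx].
  by rewrite subrr mulr0 /Phi set_itv1 Rintegral_set1 oppr0.
rewrite /Phi lerNr -mulrN opprB -phi_FTC// -RintegralZl//; last exact: phi_derive_integrable.
apply: le_Rintegral => //.
- exact: id_phi_derive_integrable.
- apply: (@eq_integrable _ _ _ mu _ _ (fun y => z%:E * (derive1 phi y)%:E)%E) => //.
  by apply: integrableZl => //; exact: phi_derive_integrable.
- move=> y /=; rewrite in_itv/= => /andP[zy _].
  by apply: ler_wnM2r => //; apply: phi_derive_le0; exact: lt_le_trans zy.
Qed.

Lemma Phi_out (x z : R) : x < z -> Phi phi x z = 0.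
Proof.
by move=> xz; rewrite /Phi set_itv_ge ?Rintegral_set0 ?oppr0// bnd_simp -ltNge.
Qed.

Lemma Phi_ge0 (x z : R) : 0 < z -> 0 <= Phi phi x z.
Proof.
move=> z0; have [zx|xz] := leP z x; last by rewrite Phi_out.
by apply: le_trans (Phi_ge z0 zx); rewrite mulr_ge0 ?(ltW z0)// subr_ge0; exact: phi_ni.
Qed.

Lemma Phi_add (a b c : R) : 0 < a -> a <= b -> b <= c ->
  Phi phi c a = Phi phi b a + Phi phi c b.
Proof.
move=> a0 ab bc; have ia := id_phi_derive_integrable c a0.
have := @Rintegral_itvB _ _ (BLeft a) (BRight c) b ia.
rewrite !bnd_simp => /(_ ab bc) h.
rewrite /Phi -opprD; congr (- _).
rewrite -(Rintegral_itv_obnd_cbnd (r := b)); last first.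
  by apply: integrableS ia => //; apply: subset_itv; rewrite bnd_simp.
by rewrite -h addrC subrK.
Qed.

(** Below [z] the integral is over an empty interval, so monotonicity holds on the whole line, which
    is the form that yields measurability. *)
Lemma Phi_nd (z x y : R) : 0 < z -> x <= y -> Phi phi x z <= Phi phi y z.
Proof.
move=> z0 xy; have [zx|xz] := leP z x; last by rewrite Phi_out ?Phi_ge0.
rewrite (Phi_add z0 zx xy) lerDl Phi_ge0//; exact: lt_le_trans zx.
Qed.

Section PhiMeasurable.
Context {d : measure_display} {T : measurableType d}.

Lemma near_inv_lt (x : R) : 0 < x -> \forall n \near \oo, (n.+1%:R^-1 : R) < x.
Proof. by move=> x0; exact: near_infty_natSinv_lt (PosNum x0). Qed.

(** Cutting the argument off at 1/(n+1) turns [phi] into a function monotone on the whole line,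
    hence measurable; at each point the resulting sequence is eventually constant. *)
Lemma measurable_phi_comp (f : T -> R) : measurable_fun [set: T] f ->
  (forall w, 0 < f w) -> measurable_fun [set: T] (phi \o f).
Proof.
move=> mf f0.
apply: (@measurable_fun_cvg _ _ _ _ (fun n w => phi (Num.max (f w) n.+1%:R^-1))).
  move=> n.
  suff mm : measurable_fun [set: R] (fun x => phi (Num.max x n.+1%:R^-1)).
    exact: (measurableT_comp mm mf).
  apply: nonincreasing_measurable => // x y xy; apply: phi_ni.
    by rewrite lt_max invr_gt0 ltr0n orbT.
  by rewrite ge_max !le_max xy lexx !orbT.
move=> w _; apply: cvg_near_cst; apply: filterS (near_inv_lt (f0 w)) => n hn.
by rewrite max_l// ltW.
Qed.

(** Additivity writes this function of two variables, for large n, as a difference of two functions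
    of one variable with common base point 1/(n+1), each monotone. *)
Lemma measurable_Phi_comp (f g : T -> R) :
  measurable_fun [set: T] f -> measurable_fun [set: T] g ->
  (forall w, 0 < g w) -> (forall w, g w <= f w) ->
  measurable_fun [set: T] (fun w => Phi phi (f w) (g w)).
Proof.
move=> mf mg g0 gf.
have mPhi n (h : T -> R) : measurable_fun [set: T] h ->
    measurable_fun [set: T] (fun w => Phi phi (h w) n.+1%:R^-1).
  move=> mh; suff mm : measurable_fun [set: R] (fun x => Phi phi x n.+1%:R^-1).
    exact: (measurableT_comp mm mh).
  by apply: nondecreasing_measurable => // x y; apply: Phi_nd; rewrite invr_gt0 ltr0n.
apply: (@measurable_fun_cvg _ _ _ _
  (fun n w => Phi phi (f w) n.+1%:R^-1 - Phi phi (g w) n.+1%:R^-1)).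
  by move=> n; apply: measurable_funB; exact: mPhi.
move=> w _; apply: cvg_near_cst; apply: filterS (near_inv_lt (g0 w)) => n hn.
by rewrite (@Phi_add n.+1%:R^-1 (g w) (f w))// ?ltW// ?invr_gt0 ?ltr0n// addrC addKr.
Qed.

End PhiMeasurable.

End PhiTheory.

(** * Running maxima of continuous paths *)

Section Paths.
Context {R : realType}.
Variable x : R -> R.
Hypothesis cx : {within `[0, +oo[, continuous x}.
Let S t := sup [set x s | s in `[0, t]].

Lemma path_continuous_segment (a b : R) : 0 <= a -> {within `[a, b], continuous x}.
Proof.
move=> a0; apply: continuous_subspaceW cx => t /=.
by rewrite !in_itv/= andbT => /andP[/(le_trans a0)].
Qed.

Lemma sup_path_ub s t : 0 <= s -> s <= t -> x s <= S t.
Proof.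
move=> s0 st; apply: ub_le_sup; last by exists s => //=; rewrite in_itv/= s0.
have [c _ hc] := EVT_max (le_trans s0 st) (@path_continuous_segment 0 t (lexx 0)).
by exists (x c) => _ /= [u ut <-]; exact: hc.
Qed.

Lemma sup_path_le t y : 0 <= t -> (forall s, 0 <= s -> s <= t -> x s <= y) -> S t <= y.
Proof.
move=> t0 h; apply: ge_sup.
  by exists (x 0); exists 0 => //=; rewrite in_itv/= lexx.
by move=> _ /= [s + <-]; rewrite in_itv/= => /andP[]; exact: h.
Qed.

Lemma sup_path_nd s t : 0 <= s -> s <= t -> S s <= S t.
Proof.
move=> s0 st; apply: sup_path_le => // u u0 us.
by apply: sup_path_ub => //; exact: le_trans st.
Qed.

(** Compactness of [0, t] turns the neighbourhoods given by pointwise continuity into one threshold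
    for [n]; K/(n+1) stands for the mesh of a partition. *)
Lemma path_unif_cont (t K delta : R) : 0 < delta -> 0 <= K ->
  \forall n \near \oo, forall u v, 0 <= u -> u <= t -> 0 <= v -> v <= t ->
    `|u - v| <= K / n.+1%:R -> `|x u - x v| <= delta.
Proof.
move=> d0 K0.
have /compact_near_coveringP/near_covering_withinP nc := @segment_compact R 0 t.
have := nc _ \oo (fun n u => forall v, 0 <= v -> v <= t ->
  `|u - v| <= K / n.+1%:R -> `|x u - x v| <= delta) _.
case=> [u /= ut|].
  have /subspace_continuousP/(_ u ut) cxu := @path_continuous_segment 0 t (lexx 0).
  have d20 : 0 < delta / 2 by rewrite divr_gt0.
  move/cvgrPdist_le: cxu => /(_ _ d20)[r /= r0 hr].
  have r20 : 0 < r / 2 by rewrite divr_gt0.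
  have hn : \forall n \near \oo, K / n.+1%:R < r / 2.
    have Kr : 0 < r / 2 / (K + 1) by rewrite divr_gt0// ltr_wpDl.
    apply: filterS (near_inv_lt Kr) => n; rewrite ltr_pdivlMr ?ltr_wpDl// => h.
    apply: le_lt_trans h; rewrite mulrC ler_pM2l ?invr_gt0 ?ltr0n//; lra.
  exists (ball u (r / 2), [set n | K / n.+1%:R < r / 2]) => /=.
    by split => //; exact: nbhsx_ballx.
  move=> [u' n] /= [bu hn'] u't v v0 vt uv.
  have ru' : `|x u - x u'| <= delta / 2.
    apply: hr => //; rewrite /ball/=; apply: lt_le_trans bu _; lra.
  have rv : `|x u - x v| <= delta / 2.
    apply: hr; last by rewrite /= in_itv/= v0.
    rewrite /ball/= (_ : u - v = (u - u') + (u' - v)); last by ring.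
    apply: le_lt_trans (ler_normD _ _) _.
    by move: bu (le_lt_trans uv hn'); rewrite /ball/= => *; lra.
  rewrite (_ : x u' - x v = (x u - x v) - (x u - x u')); last by ring.
  by apply: le_trans (ler_normB _ _) _; lra.
move=> n0 _ hn0; exists n0 => // n /hn0 h u v u0 ut v0 vt; apply: h => //.
by rewrite /= in_itv/= u0.
Qed.

(** A new maximum is reached inside [u, v], where the path exceeds [x u], itself at most [S u], by
    at most [delta]. *)
Lemma sup_path_increment (u v delta : R) : 0 <= u -> u <= v -> 0 <= delta ->
  (forall r, u <= r -> r <= v -> x r - x u <= delta) -> S v - S u <= delta.
Proof.
move=> u0 uv d0 h; rewrite lerBlDl; apply: sup_path_le => [|r r0 rv].
  exact: le_trans uv.
have [ru|ur] := leP r u.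
  by apply: (le_trans (sup_path_ub r0 ru)); rewrite lerDl.
have := h r (ltW ur) rv; have := sup_path_ub u0 (lexx u); lra.
Qed.

(** Brings the supremum down to countably many times, for measurability: the rationals clipped to
    [0, t] are dense in it. *)
Lemma sup_path_countable t y : 0 <= t ->
  S t <= y <-> (forall q : rat, x (Num.max 0 (Num.min (ratr q) t)) <= y).
Proof.
move=> t0; split=> [h q|h].
  apply: le_trans h; apply: sup_path_ub; first by rewrite le_max lexx.
  by rewrite ge_max t0 ge_min lexx orbT.
apply: sup_path_le => // s s0 st; rewrite leNgt; apply/negP => yx.
have /subspace_continuousP/(_ s) := @path_continuous_segment 0 t (lexx 0).
rewrite /= in_itv/= s0 st => /(_ isT)/cvgr_gt/(_ _ yx)[r /= r0 hr].
have srs : s - r < s + r by lra.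
have [q] := rat_in_itvoo srs; rewrite in_itv/= => /andP[sq qs].
have := h q; apply/negP; rewrite -ltNge; apply: hr => /=.
  by rewrite /ball/= ltr_norml; apply/andP; split; max_lra.
by rewrite in_itv/= le_max lexx ge_max t0 ge_min lexx orbT.
Qed.

End Paths.

(** * Passage to the limit *)

Section FatouBound.
Context {d : measure_display} {T : measurableType d} {R : realType}.
Variable P : probability T R.

Lemma limn_einf_ge (u : (\bar R)^nat) (x : \bar R) :
  (\forall n \near \oo, x <= u n)%E -> (x <= limn_einf u)%E.
Proof.
move=> [n0 _ h]; rewrite limn_einf_lim; apply: lime_ge; first exact: is_cvg_einfs.
exists n0 => // n /= n0n; apply: le_ereal_inf_tmp => _ [m /= nm <-].
by apply: h => /=; exact: leq_trans nm.
Qed.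

Lemma limn_einf_le (u : (\bar R)^nat) (x : \bar R) :
  (forall n, u n <= x)%E -> (limn_einf u <= x)%E.
Proof.
move=> h; rewrite limn_einf_lim; apply: lime_le; first exact: is_cvg_einfs.
apply: nearW => n; apply: le_trans (h n); apply: ereal_inf_lbound.
by exists n => //=.
Qed.

(** The integral of a nonnegative function is a supremum over the simple functions below it, whence
    monotonicity for arbitrary functions. It serves for pathwise Stieltjes integrals seen as
    functions of the outcome, whose measurability is not at hand. *)
Lemma le_integral_outer d' (U : measurableType d')
  (mu : {measure set U -> \bar R}) (D : set U) (f g : U -> \bar R) :
  (forall x, D x -> 0 <= f x)%E -> (forall x, D x -> f x <= g x)%E ->
  (\int[mu]_(x in D) f x <= \int[mu]_(x in D) g x)%E.
Proof.
move=> f0 fg; rewrite integral_mkcond [leRHS]integral_mkcond.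
have f0' x : (0 <= (f \_ D) x)%E by rewrite patchE; case: ifPn => // /set_mem/f0.
have fg' x : ((f \_ D) x <= (g \_ D) x)%E.
  by rewrite !patchE; case: ifPn => // /set_mem/fg.
rewrite !ge0_integralTE// => [|x]; last exact: le_trans (fg' x).
apply: le_ereal_sup => _ [h /= hf <-]; exists h => // x.
exact: le_trans (fg' x).
Qed.

Variables (E : set T) (D : T -> R) (I : nat -> T -> R) (K : R).
Hypotheses (mE : measurable E) (mD : measurable_fun [set: T] D).
Hypotheses (sI : forall n, sq_int P (I n))
           (IK : forall n, \int[P]_w (I n w ^+ 2) <= K)
           (I0 : forall n, \int[P]_w (\1_E w * I n w) = 0).
Hypothesis ID : {ae P, forall w, E w -> forall delta, 0 < delta ->
  \forall n \near \oo, I n w <= D w + delta}.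

Lemma integral_pos_sq_le (k : R) n : 0 < k ->
  (\int[P]_(w in E) (Num.max (k - I n w) 0)%:E <= k%:E * P E + (K / k)%:E)%E.
Proof.
move=> k0; have [mI iI2] := sI n.
have m1 : measurable_fun [set: T] (\1_E : T -> R) by exact: measurable_indic.
have b1 w : `|\1_E w : R| <= 1 by rewrite indicE; case: (_ \in _); rewrite ?normr1 ?normr0.
have iE : P.-integrable [set: T] (EFin \o (fun w => k * \1_E w)).
  by apply: integrable_realZ; exact: integrable_indic.
have iEI := integrable_bounded_mul m1 b1 (sq_int_integrable (sI n)).
have iEI2 : P.-integrable [set: T] (EFin \o (fun w => k^-1 * (\1_E w * I n w ^+ 2))).
  by apply: integrable_realZ; exact: integrable_bounded_mul m1 b1 iI2.
pose g w := k * \1_E w - \1_E w * I n w + k^-1 * (\1_E w * I n w ^+ 2).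
have ig : P.-integrable [set: T] (EFin \o g).
  by apply: integrable_realD => //; exact: integrable_realB.
apply: (@le_trans _ _ (\int[P]_w (g w)%:E)%E).
  rewrite integral_mkcond; apply: ge0_le_integral => //.
  - by move=> w _; rewrite patchE; case: ifP => // _; rewrite lee_fin le_max lexx orbT.
  - apply/(measurable_restrictT _ _).1 => //; apply: measurable_funTS.
    by apply/measurable_EFinP; apply: measurable_maxr => //; exact: measurable_funB.
  - exact: measurable_int ig.
  - move=> w _; rewrite patchE /g indicE; case: ifPn => wE; rewrite lee_fin; last first.
      by rewrite mul0r !mulr0 mul0r subrr add0r mulr0.
    rewrite mulr1 !mul1r.
    have kk : k * k^-1 = 1 by rewrite mulfV// gt_eqF.
    have k1 : 0 < k^-1 by rewrite invr_gt0.
    (* Completing the square shows that the bound is nonnegative, as the comparison with a positive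
       part requires. *)
    have h : k - I n w + k^-1 * I n w ^+ 2 = k^-1 * ((I n w - k / 2) ^+ 2 + 3 / 4 * k ^+ 2).
      rewrite [in RHS]sqrrB; move: kk; set j := k^-1 => kk.
      rewrite !mulrDr.
      transitivity (k * (k * j) - I n w * (k * j) + j * I n w ^+ 2).
        by rewrite kk !mulr1.
      by rewrite mulr2n; field.
    rewrite ge_max; apply/andP; split.
      by rewrite lerDl mulr_ge0 ?sqr_ge0// ltW.
    by rewrite h mulr_ge0 ?(ltW k1)// addr_ge0 ?sqr_ge0// mulr_ge0 ?sqr_ge0//; lra.
rewrite -(fineK (integrable_fin_num measurableT ig)).
rewrite -/(Rintegral P setT g) /g RintegralD//; last exact: integrable_realB.
rewrite RintegralB// I0 subr0 RintegralZl//; last exact: integrable_indic.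
rewrite RintegralZl//; last exact: integrable_bounded_mul m1 b1 iI2.
have -> : \int[P]_w \1_E w = fine (P E) by rewrite /Rintegral integral_indic// setIT.
rewrite EFinD EFinM fineK ?fin_num_measure// leeD2l// lee_fin mulrC.
apply: ler_wpM2r; first by rewrite invr_ge0 ltW.
apply: le_trans (IK n); apply: le_Rintegral => //.
  exact: integrable_bounded_mul m1 b1 iI2.
by move=> w _; rewrite ler_piMl ?sqr_ge0//; have := b1 w; apply: le_trans; exact: ler_norm.
Qed.

(** The asymptotic bound of [I n] by [D] is one-sided, but in the useful direction: (k - D)^+ is at
    most the lower limit of (k - I_n)^+, whose integrals are bounded uniformly in n. *)
Lemma fatou_bound (k : R) : 0 < k ->
  (\int[P]_(w in E) (Num.max (k - D w) 0)%:E <= k%:E * P E + (K / k)%:E)%E.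
Proof.
move=> k0.
pose f n w := (Num.max (k - I n w) 0)%:E.
have mf n : measurable_fun E (f n).
  apply: measurable_funTS; apply/measurable_EFinP; apply: measurable_maxr => //.
  by apply: measurable_funB => //; exact: (sI n).1.
have f0 n w : E w -> (0 <= f n w)%E by rewrite lee_fin le_max lexx orbT.
apply: (@le_trans _ _ (\int[P]_(w in E) limn_einf (f^~ w))%E).
  apply: ae_ge0_le_integral => //.
  - by move=> w _; rewrite lee_fin le_max lexx orbT.
  - apply: measurable_funTS; apply/measurable_EFinP; apply: measurable_maxr => //.
    exact: measurable_funB.
  - by move=> w Ew; apply: limn_einf_ge; apply: nearW => n; exact: f0.
  - rewrite (_ : (fun w => _) = fun w => limn (einfs (f^~ w))); last first.
      by apply/funext => w; rewrite limn_einf_lim.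
    apply: (emeasurable_fun_cvg (fun n w => einfs (f^~ w) n)).
      by move=> n; exact: measurable_fun_einfs.
    by move=> w _; exact: is_cvg_einfs.
  - apply: filterS ID => w IDw Ew; apply/lee_addgt0Pr => e e0.
    rewrite -leeBlDr//; apply: limn_einf_ge.
    apply: filterS (IDw Ew e e0) => n hn.
    by rewrite /f -EFinB lee_fin; max_lra.
apply: le_trans (fatou P mE mf f0) _.
by apply: limn_einf_le => n; exact: integral_pos_sq_le.
Qed.

End FatouBound.

Section BoundConsequence.
Context {d : measure_display} {T : measurableType d} {R : realType}.
Variables (P : probability T R) (E : set T) (D : T -> R) (K : R).
Hypotheses (mE : measurable E) (mD : measurable_fun [set: T] D) (K0 : 0 <= K).
Hypothesis bD : forall k : R, 0 < k ->
  (\int[P]_(w in E) (Num.max (k - D w) 0)%:E <= k%:E * P E + (K / k)%:E)%E.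

(** Rests on (k - D)^+ + min(D^+, k) = k + D^-. With [bD] it bounds the integral of D^- by that of
    min(D^+, k) plus K/k, which is arbitrarily small. Finiteness comes from k = 1, as D^- <= (1 -
    D)^+. *)
Lemma neg_part_le_pos_part :
  (\int[P]_(w in E) (Num.max (- D w) 0)%:E < +oo)%E /\
  (\int[P]_(w in E) (Num.max (- D w) 0)%:E <= \int[P]_(w in E) (Num.max (D w) 0)%:E)%E.
Proof.
have mpos (f : T -> R) : measurable_fun setT f ->
    measurable_fun E (fun w => (Num.max (f w) 0)%:E).
  by move=> mf; apply/measurable_funTS/measurable_EFinP; exact: measurable_maxr.
have pos0 (x : R) : (0 <= (Num.max x 0)%:E)%E by rewrite lee_fin le_max lexx orbT.
have mkD k : measurable_fun setT (fun w => k - D w) by exact: measurable_funB.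
have mND := measurable_funN mD.
have PEfin : P E \is a fin_num by exact: fin_num_measure.
split.
  apply: (@le_lt_trans _ _ (\int[P]_(w in E) (Num.max (1 - D w) 0)%:E)%E).
    apply: ge0_le_integral => //; [exact: mpos|exact: mpos|].
    by move=> w _; rewrite lee_fin; max_lra.
  by apply: le_lt_trans (bD ltr01) _; rewrite -(fineK PEfin) -EFinM -EFinD ltry.
apply/lee_addgt0Pr => e e0.
have [k k0 kK] : exists2 k : R, 0 < k & K / k <= e.
  exists ((K + 1) / e); first by rewrite divr_gt0// ltr_wpDl.
  rewrite invf_div mulrA ler_pdivrMr ?ltr_wpDl// mulrC ler_pM2l//; lra.
pose m w := Num.min (Num.max (D w) 0) k.
have mm : measurable_fun setT m by apply: measurable_minr => //; exact: measurable_maxr.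
have m0 w : (0 <= (m w)%:E)%E by rewrite lee_fin le_min le_max lexx orbT/= ltW.
have mmE : measurable_fun E (EFin \o m) by apply/measurable_funTS/measurable_EFinP.
apply: (@le_trans _ _ (\int[P]_(w in E) (m w)%:E + e%:E)%E); last first.
  rewrite leeD2r//; apply: ge0_le_integral => //; first exact: mpos.
  by move=> w _; rewrite lee_fin ge_min lexx.
have eqI : (\int[P]_(w in E) (Num.max (k - D w) 0)%:E + \int[P]_(w in E) (m w)%:E =
    k%:E * P E + \int[P]_(w in E) (Num.max (- D w) 0)%:E)%E.
  rewrite -ge0_integralD//; last exact: mpos.
  rewrite -(integral_cst P mE k%:E) -ge0_integralD//; last exact: mpos.
  - by apply: eq_integral => w _ /=; rewrite -!EFinD /m; congr EFin; max_lra.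
  - by move=> w _; rewrite lee_fin ltW.
have kPfin : (k%:E * P E)%E \is a fin_num by rewrite fin_numM.
rewrite -(leeD2lE _ _ kPfin) -eqI.
apply: (@le_trans _ _ (k%:E * P E + (K / k)%:E + \int[P]_(w in E) (m w)%:E)%E).
  by rewrite leeD2r// bD.
by rewrite -addeA leeD2l// addeC leeD2l// lee_fin.
Qed.

End BoundConsequence.

(** * Summation by parts along the running maximum *)

Section AbelSummation.
Context {R : realType}.
Variable phi : R -> R.
Hypotheses (phiC1 : C1_pos phi) (phi_ni : nonincreasing_pos phi).

(* Summation by parts of [phi(S_i) M_i]; the drift term is controlled because
   [M_i = X_i - A_i <= S_i] and [phi] is nonincreasing. *)
Lemma abel_Phi_ge (S M : nat -> R) (delta : R) n :
  0 < S 0%N -> (forall i, S i <= S i.+1) -> (forall i, M i <= S i) ->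
  (forall i, (i < n)%N -> S i.+1 - S i <= delta) ->
  \sum_(i < n) phi (S i) * (M i.+1 - M i) - delta * (phi (S 0%N) - phi (S n)) <=
  phi (S n) * M n - phi (S 0%N) * M 0%N + Phi phi (S n) (S 0%N).
Proof.
move=> S0 Snd MS; elim: n => [|n IH] hd.
  rewrite big_ord0 !subrr mulr0 subr0 add0r; exact: Phi_ge0.
have {}IH := IH (fun i hi => hd i (ltnW hi)).
have hdn := hd n (ltnSn n).
have S0n m : S 0%N <= S m by elim: m => // m /le_trans; apply.
have Sn0 : 0 < S n := lt_le_trans S0 (S0n n).
rewrite big_ord_recr/= (Phi_add phiC1 S0 (S0n n) (Snd n)).
have := Phi_ge phiC1 phi_ni Sn0 (Snd n).
have dphi : phi (S n.+1) <= phi (S n) by exact: phi_ni.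
(* M_{n+1} is bounded by S_{n+1}, whereas [Phi_ge] offers the factor S_n. The gap costs at most
   [delta] times the decrease of [phi] over the step, and these decreases telescope. *)
have h1 : 0 <= (S n.+1 - M n.+1) * (phi (S n) - phi (S n.+1)).
  by rewrite mulr_ge0// subr_ge0.
have h2 : 0 <= (delta - (S n.+1 - S n)) * (phi (S n) - phi (S n.+1)).
  by rewrite mulr_ge0// subr_ge0.
move: IH h1 h2; set I := \sum_(i < n) _; rewrite !mulrBl !mulrBr; lra.
Qed.

End AbelSummation.

(** * Stieltjes measures of paths *)

Section Stieltjes.
Context {R : realType}.
Variable q : R -> R.
Hypotheses (q_nd : forall s t, 0 <= s -> s <= t -> q s <= q t)
           (q_rc : right_continuous_path q).

(** Places such a path in the first branch of [stieltjes]: extension by the value at 0 preserves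
    monotonicity and right-continuity. *)
Lemma stieltjes_cumulative :
  exists f : cumulative R R, forall t, f t = q (Num.max 0 t).
Proof.
pose f t := q (Num.max 0 t).
have f_nd : {homo f : x y / x <= y}.
  move=> x y xy; apply: q_nd; first by rewrite le_max lexx.
  by rewrite ge_max !le_max lexx xy orbT.
have f_rc : right_continuous f.
  move=> t; have [t0|t0] := leP 0 t.
    rewrite /f (max_r t0).
    apply: cvg_trans (q_rc t0); apply: near_eq_cvg; near=> s.
    by rewrite max_r// (le_trans t0)// ltW//; near: s; exact: nbhs_right_gt.
  apply: cvg_near_cst; near=> s; rewrite /f !max_l ?(ltW t0)//.
  by near: s; apply: nbhs_right_le.
pose fc := isCumulative.Build R _ R f f_nd f_rc.
pose F : cumulative R R := HB.pack f fc.
by exists F.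
Unshelve. all: by end_near. Qed.

Lemma stieltjes_oc (a b : R) : 0 <= a -> a <= b ->
  stieltjes q `]a, b]%classic = (q b - q a)%:E.
Proof.
move=> a0 ab; rewrite /stieltjes; case: pselect => [h|]; last first.
  by move=> /(_ stieltjes_cumulative).
case: (cid h) => f /= hf.
rewrite /lebesgue_stieltjes_measure/= /measure_extension/=.
rewrite measurable_mu_extE//; last exact: is_ocitv.
change (wlength f `]a, b]%classic = (q b - q a)%:E).
by rewrite wlength_itv_bnd// !hf !max_r// (le_trans a0).
Qed.

(** The sum is the integral of the step function with value [k i] on ]tm i, tm (i+1)], which lies
    below [g]. *)
Lemma stieltjes_step_le (tm k : nat -> R) n (D : set R) (g : R -> \bar R) :
  0 <= tm 0%N -> (forall i, tm i <= tm i.+1) -> (forall i, 0 <= k i) ->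
  measurable D -> `]tm 0%N, tm n] `<=` D ->
  (forall u, D u -> 0 <= g u)%E ->
  (forall i u, (i < n)%N -> tm i < u -> u <= tm i.+1 -> ((k i)%:E <= g u)%E) ->
  ((\sum_(i < n) k i * (q (tm i.+1) - q (tm i)))%:E <= \int[stieltjes q]_(u in D) g u)%E.
Proof.
move=> tm0 tmS k0 mD tmD g0 kg.
have tmle i j : (i <= j)%N -> tm i <= tm j.
  by move=> ij; apply: (@homo_leq _ tm <=%R) ij => //; exact: le_trans.
have mI i : measurable (`]tm i, tm i.+1]%classic : set (measurableTypeR R)).
  exact: measurable_itv.
pose h (i : nat) (u : measurableTypeR R) : \bar R := (k i * \1_(`]tm i, tm i.+1]%classic) u)%:E.
apply: (@le_trans _ _ (\int[stieltjes q]_(u in D) \sum_(i < n) h i u)%E); last first.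
  apply: le_integral_outer.
    by move=> u _; apply: sume_ge0 => i _; rewrite lee_fin mulr_ge0.
  move=> u Du; have [[i ui]|] := pselect (exists i : 'I_n, u \in `]tm i, tm i.+1]).
    rewrite (bigD1 i)//= big1 ?adde0.
      rewrite /h indicE mem_set//= mulr1.
      by move: ui; rewrite in_itv/= => /andP[]; exact: kg.
    move=> j ji; rewrite /h indicE memNset ?mulr0//= => uj.
    move: ui uj; rewrite !in_itv/= => /andP[iu ui] /andP[ju uj].
    move: ji; rewrite -val_eqE neq_ltn => /orP[|] lt_ij.
      by have := lt_le_trans iu (le_trans uj (tmle _ _ lt_ij)); rewrite ltxx.
    by have := lt_le_trans ju (le_trans ui (tmle _ _ lt_ij)); rewrite ltxx.
  move=> nex; rewrite big1 ?g0// => i _; rewrite /h indicE memNset ?mulr0//= => ui.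
  by apply: nex; exists i.
have mh i : measurable_fun D (h i).
  apply: measurable_funTS; apply/measurable_EFinP; exact: measurable_funM.
rewrite ge0_integral_sum//; last 2 first.
- by move=> i; exact: mh.
- by move=> i u _; rewrite lee_fin mulr_ge0.
rewrite -sumEFin; apply: lee_sum => i _.
under eq_integral do rewrite /h EFinM.
rewrite ge0_integralZl ?lee_fin//; last first.
  by apply: measurable_funTS; apply/measurable_EFinP; exact: measurable_indic.
rewrite integral_indic// (_ : _ `&` D = `]tm i, tm i.+1]%classic).
  by rewrite stieltjes_oc// ?EFinM//; apply: le_trans tm0 _; exact: tmle.
apply/setIidPl; apply: subset_trans tmD => u /=; rewrite !in_itv/= => /andP[iu ui].
by rewrite (le_lt_trans (tmle _ _ (leq0n i)) iu) (le_trans ui (tmle _ _ (ltn_ord i))).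
Qed.

End Stieltjes.

(** * The process Z *)

(** Either |y| <= m, or y < -m and then [p] is further still from 0. In use, [p] is a value of
    phi(S) in the energy and [y] a truncated coefficient. *)
Lemma sqr_sub_le (R : realDomainType) (p y m : R) : 0 <= m -> p <= y -> y <= m ->
  y ^+ 2 - m ^+ 2 <= p ^+ 2.
Proof.
move=> m0 py ym; have [my|ym'] := leP (- m) y.
  have : 0 <= (m - y) * (m + y) by apply: mulr_ge0; lra.
  have := sqr_ge0 p; lra.
have : 0 <= (y - p) * (- y - p) by apply: mulr_ge0; lra.
have := sqr_ge0 m; lra.
Qed.

(** Here [v] is the increment of [Phi]: the surplus (al - 1) v is nonnegative, so alpha = 1 is the
    worst case. *)
Lemma increment_combine (R : realDomainType) (I dl dl' b a u v al : R) :
  0 < dl' -> 0 <= (al - 1) * v -> I - (dl - dl') <= b - a + v ->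
  I <= b + al * (u + v) - (a + al * u) + dl.
Proof. by rewrite mulrBl mul1r mulrDr; lra. Qed.

(** * Completeness of the filtration and passage to the opposite process *)

Section UsualConditions.
Context {d : measure_display} {T : measurableType d} {R : realType}.
Variables (P : probability T R) (F : R -> set (set T)).
Hypothesis hF : usual_conditions P F.

Lemma usual_filtration : filtration F.
Proof. by case: hF. Qed.

Lemma usual_negligible t (N : set T) : 0 <= t -> P.-negligible N -> F t N.
Proof.
by move=> t0 nN; case: hF => -[_ h] hN _; apply: (h 0 t (lexx 0) t0); exact: hN.
Qed.

(** The two preimages differ within a negligible set, which belongs to every [F t]; adaptedness may
    thus be checked on a version. *)
Lemma measurable_wrt_ae t d' (U : measurableType d') (f g : T -> U) : 0 <= t ->
  {ae P, forall w, f w = g w} ->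
  measurable_wrt (F t) f -> measurable_wrt (F t) g.
Proof.
move=> t0 fg mf B mB; have sF := filtration_sigma usual_filtration t0.
have Fset := measurable_wrt_setP sF.
have nfg : P.-negligible (~` [set w | f w = g w]) by exact: fg.
rewrite (_ : g @^-1` B = (f @^-1` B `&` [set w | f w = g w]) `|`
    (g @^-1` B `&` ~` [set w | f w = g w])).
  apply/Fset/measurableU; last first.
    apply/Fset; apply: usual_negligible => //.
    by apply: negligibleS nfg => w [].
  apply: measurableI; first by apply/Fset; exact: mf.
  by rewrite -[X in measurable X]setCK; apply: measurableC; apply/Fset; exact: usual_negligible.
apply/seteqP; split=> w /=.
  by move=> gB; have [e|ne] := pselect (f w = g w); [left; rewrite e|right].
by move=> [[fB <-]|[]].
Qed.

End UsualConditions.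

Section GenSuper.
Context {d : measure_display} {T : measurableType d} {R : realType}.
Variables (P : probability T R) (F : R -> set (set T)).
Hypothesis hF : usual_conditions P F.

(** A change of sign exchanges [U] and [V]. The processes are only assumed opposite almost surely,
    because the sign rule for [Phi] asks for a positive running maximum. *)
Lemma gen_super_of_opp (a : R) (Z Z' : R -> T -> R) : 0 <= a ->
  (forall t, a <= t -> {ae P, forall w, Z' t w = - Z t w}) ->
  gen_submartingale P a F Z' -> gen_supermartingale P a F Z.
Proof.
move=> a0 ZZ' [aZ' hZ']; have fF := usual_filtration hF.
have aZ : adapted a F Z.
  move=> t at_; have t0 := le_trans a0 at_.
  apply: (@measurable_wrt_ae _ _ _ _ _ hF _ _ _ (fun w => - Z' t w)) => //.
    by apply: filterS (ZZ' t at_) => w ->; rewrite opprK.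
  have sF := filtration_sigma fF t0.
  by apply/(measurable_wrtP sF)/measurable_funN/(measurable_wrtP sF); exact: aZ'.
split=> // s t as_ st; have at_ := le_trans as_ st.
have t0 := le_trans a0 at_; have s0 := le_trans a0 as_.
have mZ : measurable_fun [set: T] (EFin \o Z t).
  by apply/measurable_EFinP; exact: (filtration_fun fF t0 (aZ t at_)).
have mZ' : measurable_fun [set: T] (EFin \o Z' t).
  by apply/measurable_EFinP; exact: (filtration_fun fF t0 (aZ' t at_)).
have [W [[U [V [[U0 mU UE] [V0 mV VE] UVfin WE]]] ZW]] := hZ' s t as_ st.
exists (fun w => - W w)%E; split.
  exists V, U; split.
  - split => // E FE; rewrite VE//; have mE := filtration_measurable fF s0 FE.
    apply: ge0_ae_eq_integral => //.
    + by apply: measurable_funTS; exact: measurable_funeneg.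
    + by apply: measurable_funTS; exact: measurable_funepos.
    + by apply: filterS (ZZ' t at_) => w e _; rewrite funenegE funeposE/= e opprK.
  - split => // E FE; rewrite UE//; have mE := filtration_measurable fF s0 FE.
    apply: ge0_ae_eq_integral => //.
    + by apply: measurable_funTS; exact: measurable_funepos.
    + by apply: measurable_funTS; exact: measurable_funeneg.
    + by apply: filterS (ZZ' t at_) => w e _; rewrite funenegE funeposE/= e.
  - by apply: filterS UVfin => w [|]; [right|left].
  - apply: filterS2 WE UVfin => w -> UV.
    (* -(U - V) = V - U could fail only when both are infinite, which [UVfin] excludes. *)
    move: (U0 w) (V0 w) UV; case: (U w) => [u| |]; case: (V w) => [v| |] //=.
      by rewrite -EFinB opprB.
    by move=> _ _ [].
apply: filterS2 ZW (ZZ' s as_) => w + e.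
by rewrite e leeNl.
Qed.

End GenSuper.

(** * The submartingale inequality for a non-increasing function *)

Section MainEstimate.
Context {d : measure_display} {T : measurableType d} {R : realType}.
Variables (P : probability T R) (F : R -> set (set T)) (X M A Q : R -> T -> R).
Variable eps : R.
Hypotheses (hF : usual_conditions P F) (aX : adapted 0 F X)
  (hXc : continuous_paths P X) (hDM : doob_meyer P F X M A)
  (hQ : quadratic_variation P F M Q)
  (hXmax : forall t : R, 0 < t -> {ae P, forall w, 0 < running_max X t w})
  (heps : 0 < eps).
Let fF := usual_filtration hF.

(** Collects the almost sure path properties in one event. Its complement is negligible, so it lies
    in every [F t] and processes can be modified off it without losing adaptedness. *)
Definition good (w : T) := [/\ {within `[0, +oo[, continuous (fun t => X t w)},
  forall t, 0 <= t -> M t w = X t w - A t w,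
  forall t, 0 <= t -> 0 <= A t w,
  (forall s t, 0 <= s -> s <= t -> Q s w <= Q t w) /\
    right_continuous_path (fun t => Q t w) &
  0 < running_max X eps w].

Lemma good_ae : {ae P, forall w, good w}.
Proof.
have [XMA _ [[_ _ A0 And _] _]] := hDM.
have [[_ _ _ Qnd Qrc] _ _] := hQ.
near=> w; split.
- by near: w; exact: hXc.
- move=> t t0; suff: X t w = M t w + A t w by move=> ->; rewrite addrK.
  by move: t t0; near: w; exact: XMA.
- move=> t t0; suff /(_ 0 t (lexx 0) t0) : forall s t, 0 <= s -> s <= t -> A s w <= A t w.
    by apply: le_trans; rewrite le_eqVlt; apply/orP; left; apply/eqP/esym; near: w.
  by near: w; exact: And.
- by split; near: w.
- by near: w; exact: hXmax.
Unshelve. all: by end_near. Qed.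

Lemma F_good t : 0 <= t -> F t [set w | good w].
Proof.
move=> t0; apply/(measurable_wrt_setP (filtration_sigma fF t0)).
rewrite -[X in measurable X]setCK; apply: measurableC.
apply/(measurable_wrt_setP (filtration_sigma fF t0)).
by apply: (usual_negligible hF) => //; exact: good_ae.
Qed.

(* A version of the running maximum that is adapted, nondecreasing and positive
   from time [eps] on for every outcome. *)
Definition Smax (t : R) (w : T) : R :=
  if `[< good w >] then running_max X t w else 1.

Lemma Smax_good t w : good w -> Smax t w = running_max X t w.
Proof. by move=> gw; rewrite /Smax asboolT. Qed.

Lemma Smax_nd s t w : 0 <= s -> s <= t -> Smax s w <= Smax t w.
Proof.
move=> s0 st; rewrite /Smax; case: asboolP => // -[cX _ _ _ _].
exact: (sup_path_nd cX).
Qed.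

Lemma Smax_gt0 t w : eps <= t -> 0 < Smax t w.
Proof.
move=> et; apply: (@lt_le_trans _ _ (Smax eps w)).
  by rewrite /Smax; case: asboolP => // -[].
by apply: Smax_nd => //; exact: ltW.
Qed.

Lemma Smax_measurable t : 0 <= t -> measurable_wrt (F t) (Smax t).
Proof.
move=> t0; have sF := filtration_sigma fF t0.
have Fset := measurable_wrt_setP sF.
apply/(measurable_wrtP sF).
apply: (measurability (@RGenOInfty.G R)) => [|/= _ [_] [y] -> <-].
  exact: RGenOInfty.measurableE.
rewrite setTI (_ : _ @^-1` _ = ([set w | good w] `&`
    \bigcup_(q : rat) [set w | y < X (Num.max 0 (Num.min (ratr q) t)) w]) `|`
    (~` [set w | good w] `&` [set w | y < 1])).
  have mg := (Fset _).1 (F_good t0).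
  apply: measurableU.
    apply: measurableI => //; apply: bigcupT_measurable_rat => q.
    set u := Num.max _ _.
    have u0 : 0 <= u by rewrite le_max lexx.
    have ut : u <= t by rewrite ge_max t0 ge_min lexx orbT.
    apply/Fset; rewrite (_ : [set w | _] = X u @^-1` `]y, +oo[); last first.
      by apply/seteqP; split=> w /=; rewrite in_itv/= andbT.
    by have := filtration_le fF u0 ut (aX u0); apply.
  apply: measurableI; first exact: measurableC.
  have [y1|y1] := ltP y 1.
    by rewrite (_ : [set _ | _] = setT)//; apply/seteqP; split.
  by rewrite (_ : [set _ | _] = set0)//; apply/seteqP; split.
apply/seteqP; split=> w /=; rewrite in_itv/= andbT /Smax.
  case: asboolP => gw h; [left; split => //|by right].
  apply: contrapT => nex; move: h; apply/negP; rewrite -leNgt.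
  apply/(sup_path_countable (let: And5 c _ _ _ _ := gw in c) y t0) => q.
  by rewrite leNgt; apply/negP => qy; apply: nex; exists q.
move=> [[gw [q _ /= qy]]|[ngw y1]]; last by rewrite asboolF.
rewrite asboolT//; apply: lt_le_trans qy _.
have [cX _ _ _ _] := gw.
by apply: (sup_path_ub cX); [rewrite le_max lexx|rewrite ge_max t0 ge_min lexx orbT].
Qed.

Lemma M_le_Smax t w : good w -> 0 <= t -> M t w <= Smax t w.
Proof.
move=> gw t0; rewrite Smax_good//; have [cX ME A0 _ _] := gw.
rewrite ME// lerBlDr; apply: (@le_trans _ _ (running_max X t w)).
  exact: (sup_path_ub cX).
by rewrite lerDl A0.
Qed.

Lemma M_martingale : martingale P 0 F M. Proof. by have [_ []] := hDM. Qed.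

Variable phi : R -> R.
Hypotheses (phiC1 : C1_pos phi) (phi_ni : nonincreasing_pos phi)
  (phi_energy : finite_energy P eps phi X Q).
Variable alpha : R.
Hypothesis alpha1 : 1 <= alpha.

(** The version of Z built on [Smax], with M in place of X - A, whose measurability can be read off
    its factors. *)
Definition Zgood t w := phi (Smax t w) * M t w +
  alpha * Phi phi (Smax t w) (Smax eps w).

Lemma Zproc_good t w : 0 <= t -> good w -> Zproc X A eps phi alpha t w = Zgood t w.
Proof.
by move=> t0 gw; rewrite /Zproc /Zgood !Smax_good//; have [_ -> //] := gw.
Qed.

Lemma phi_Smax_measurable t : eps <= t -> measurable_wrt (F t) (phi \o Smax t).
Proof.
move=> et; have t0 := le_trans (ltW heps) et; have sF := filtration_sigma fF t0.
apply/(measurable_wrtP sF).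
apply: (@measurable_phi_comp _ _ phi_ni _ (g_sigma_algebraType (F t))) => [|w].
  by apply/(measurable_wrtP sF); exact: Smax_measurable.
exact: Smax_gt0.
Qed.

Lemma Zproc_measurable t : eps <= t -> measurable_wrt (F t) (Zproc X A eps phi alpha t).
Proof.
move=> et; have t0 := le_trans (ltW heps) et; have sF := filtration_sigma fF t0.
apply: (@measurable_wrt_ae _ _ _ _ _ hF _ _ _ (Zgood t)) => //.
  by apply: filterS good_ae => w gw; rewrite Zproc_good.
apply/(measurable_wrtP sF); apply: measurable_funD.
  apply: measurable_funM; apply/(measurable_wrtP sF).
    exact: phi_Smax_measurable.
  by have [_ aM _] := M_martingale; exact: aM.
apply: measurable_funM => //.
apply: (@measurable_Phi_comp _ _ phiC1 phi_ni _ (g_sigma_algebraType (F t))).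
- by apply/(measurable_wrtP sF); exact: Smax_measurable.
- apply/(measurable_wrtP sF); apply: (filtration_le fF (ltW heps) et).
  by apply: Smax_measurable; exact: ltW.
- by move=> w; exact: Smax_gt0.
- by move=> w; apply: Smax_nd => //; exact: ltW.
Qed.

Section Increment.
Variables (s t : R) (m : nat) (E : set T).
Hypotheses (es : eps <= s) (st : s < t) (FE : F s E)
  (EB : E `<=` [set w | phi (Smax s w) <= m%:R]).

Let s0 : 0 <= s := le_trans (ltW heps) es.
Let t0 : 0 <= t := le_trans s0 (ltW st).
Let tm n i := s + (t - s) * (i%:R / n.+1%:R).
Let B := [set w | phi (Smax s w) <= m%:R].
(** phi(S_{t_i}) made bounded: on [B] it is at most m because phi(S) decreases in time, and the
    maximum with -n bounds it from below. [B] is known at time s, so the coefficient stays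
    adapted. *)
Let c n i w := \1_B w * Num.max (phi (Smax (tm n i) w)) (- n%:R).
Let I n := transform M (tm n) (c n) n.+1.

Let tm_first n : tm n 0 = s.
Proof. by rewrite /tm mul0r mulr0 addr0. Qed.

Let tm_last n : tm n n.+1 = t.
Proof. by rewrite /tm divff ?mulr1 ?pnatr_eq0// addrC subrK. Qed.

Let tm_step n i : tm n i.+1 = tm n i + (t - s) / n.+1%:R.
Proof. by rewrite /tm -[i.+1%:R]natr1 [(_ + 1) / _]mulrDl mul1r mulrDr addrA. Qed.

Let tmS n i : tm n i <= tm n i.+1.
Proof. by rewrite tm_step lerDl divr_ge0// subr_ge0 ltW. Qed.

Let tm_ge n i : s <= tm n i.
Proof. by rewrite /tm lerDl mulr_ge0 ?divr_ge0// subr_ge0 ltW. Qed.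

Let tm0 n i : 0 <= tm n i.
Proof. exact: le_trans (tm_ge n i). Qed.

Let tm_le n i : (i <= n.+1)%N -> tm n i <= t.
Proof.
by move=> ni; rewrite -(tm_last n); apply: (@homo_leq _ (tm n) <=%R) ni => //; exact: le_trans.
Qed.

Let phi_tm_le n i w : phi (Smax (tm n i) w) <= phi (Smax s w).
Proof. by apply: phi_ni; [exact: Smax_gt0|exact: Smax_nd]. Qed.

Let FB : F s B.
Proof.
rewrite (_ : B = (phi \o Smax s) @^-1` `]-oo, m%:R]); last first.
  by apply/seteqP; split=> w /=; rewrite in_itv.
exact: phi_Smax_measurable.
Qed.

Let mB u : s <= u -> measurable_wrt (F u) (\1_B : T -> R).
Proof.
move=> su; apply: (filtration_le fF s0 su).
apply/(measurable_wrtP (filtration_sigma fF s0)).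
by apply: measurable_indic; apply/(measurable_wrt_setP (filtration_sigma fF s0)).
Qed.

Let mc n i : measurable_wrt (F (tm n i)) (c n i).
Proof.
apply: (measurable_wrt_mul fF) => //; first exact: mB.
have sF := filtration_sigma fF (tm0 n i).
apply/(measurable_wrtP sF); apply: measurable_maxr => //.
by apply/(measurable_wrtP sF); apply: phi_Smax_measurable; exact: le_trans (tm_ge n i).
Qed.

Let cC n i w : `|c n i w| <= m%:R + n%:R.
Proof.
rewrite /c indicE; have [wB|_] := boolP (w \in B); last by rewrite mul0r normr0 addr_ge0.
have := phi_tm_le n i w; move/set_mem: wB; rewrite /B/= mul1r ler_norml.
have n0 : 0 <= n%:R :> R by []. have m0 : 0 <= m%:R :> R by [].
by move=> h1 h2; apply/andP; split; max_lra.
Qed.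

Let energy := (\int[P]_w \int[stieltjes (fun s => Q s w)]_(u in `[eps, t])
        ((phi (running_max X u w)) ^+ 2)%:E)%E.
Let Good := [set w | good w].
(** Bounds the second moments of all [I n]: the first term pays for c^2 up to m^2, the energy for
    the rest. The indicator selects the paths on which [Q] is known to be monotone. *)
Let K := \int[P]_w (\1_Good w * (m%:R ^+ 2 * (Q t w - Q s w))) + fine energy.

Let mGood : measurable Good.
Proof. by apply: (filtration_measurable fF s0); exact: F_good. Qed.

Let Qint u : 0 <= u -> P.-integrable [set: T] (EFin \o Q u).
Proof. by have [[_ iQ _ _ _] _ _] := hQ; exact: iQ. Qed.

Let term_int n i (f : T -> R) (C : R) : measurable_fun [set: T] f ->
  (forall w, `|f w| <= C) ->
  P.-integrable [set: T] (EFin \o (fun w => f w * (Q (tm n i.+1) w - Q (tm n i) w))).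
Proof.
move=> mf fC; apply: (integrable_bounded_mul mf fC).
by apply: integrable_realB; exact: Qint.
Qed.

Let energy_fin : energy \is a fin_num.
Proof.
rewrite ge0_fin_numE; last first.
  by apply: integral_ge0 => w _; apply: integral_ge0 => u _; rewrite lee_fin sqr_ge0.
by apply: phi_energy; exact: le_lt_trans st.
Qed.

(** The part of c^2 beyond m^2, nonzero only for coefficients below -m. *)
Let excess n i w := Num.max (c n i w ^+ 2 - m%:R ^+ 2) 0.

Let excess_le n i w : 0 <= excess n i w <= (m%:R + n%:R) ^+ 2.
Proof.
rewrite /excess; have h : c n i w ^+ 2 <= (m%:R + n%:R) ^+ 2.
  by rewrite -real_normK ?num_real// lerXn2r ?nnegrE// (le_trans _ (cC n i w)).
have := sqr_ge0 (m%:R + n%:R : R); have := sqr_ge0 (m%:R : R).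
by move=> h1 h2; apply/andP; split; max_lra.
Qed.

(** For u in ]t_i, t_{i+1}], phi(S_u) is at most the truncated coefficient on [B], itself at most m;
    by [sqr_sub_le] the excess is then at most phi(S_u)^2 throughout the step. *)
Let excess_energy n : (\int[P]_w (\1_Good w * \sum_(i < n.+1)
   excess n i w * (Q (tm n i.+1) w - Q (tm n i) w))%:E <= energy)%E.
Proof.
apply: le_integral_outer => w _; rewrite indicE.
  have [/set_mem [_ _ _ [Qnd _] _]|_] := boolP (w \in Good); last by rewrite mul0r.
  rewrite mul1r lee_fin sumr_ge0// => i _; rewrite mulr_ge0 ?subr_ge0 ?Qnd//.
  by have /andP[] := excess_le n i w.
have [/set_mem gw|_] := boolP (w \in Good); last first.
  by rewrite mul0r; apply: integral_ge0 => u _; rewrite lee_fin sqr_ge0.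
rewrite mul1r; have [_ _ _ [Qnd Qrc] _] := gw.
apply: (@stieltjes_step_le _ (fun u => Q u w) Qnd Qrc (tm n) (fun i => excess n i w)) => //.
- by move=> i; have /andP[] := excess_le n i w.
- move=> u /=; rewrite !in_itv/= tm_first tm_last => /andP[su ->].
  by rewrite andbT (le_trans es)// ltW.
- by move=> u _; rewrite lee_fin sqr_ge0.
- move=> i u _ iu ui; rewrite lee_fin /excess /c indicE.
  have [wB|_] := boolP (w \in B); last first.
    by rewrite mul0r expr0n/= sub0r max_r ?sqr_ge0// oppr_le0 sqr_ge0.
  rewrite mul1r ge_max sqr_ge0 andbT.
  have h1 : phi (running_max X u w) <= phi (Smax (tm n i) w).
    rewrite -Smax_good//; apply: phi_ni; first by apply: Smax_gt0; exact: le_trans (tm_ge n i).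
    by apply: Smax_nd => //; exact: ltW.
  have h2 : phi (Smax (tm n i) w) <= m%:R by apply: le_trans (phi_tm_le n i w) _; exact: set_mem wB.
  have n0 : 0 <= n%:R :> R by []. have m0 : 0 <= m%:R :> R by [].
  move: h1 h2; set p := phi _; set p' := phi _ => h1 h2.
  have [yp ym] : p <= Num.max p' (- n%:R) /\ Num.max p' (- n%:R) <= m%:R.
    by split; max_lra.
  exact: sqr_sub_le.
Qed.

Let c2_int n i : P.-integrable [set: T]
  (EFin \o (fun w => c n i w ^+ 2 * (Q (tm n i.+1) w - Q (tm n i) w))).
Proof.
apply: (@term_int n i (fun w => c n i w ^+ 2) ((m%:R + n%:R) ^+ 2)).
  by apply: measurable_funX; exact: (filtration_fun fF (tm0 n i) (mc n i)).
by move=> w; rewrite normrX lerXn2r ?nnegrE// (le_trans _ (cC n i w)).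
Qed.

Let excess_int n i : P.-integrable [set: T]
  (EFin \o (fun w => excess n i w * (Q (tm n i.+1) w - Q (tm n i) w))).
Proof.
apply: (@term_int n i (excess n i) ((m%:R + n%:R) ^+ 2)).
  apply: measurable_maxr => //; apply: measurable_funB => //.
  by apply: measurable_funX; exact: (filtration_fun fF (tm0 n i) (mc n i)).
by move=> w; have /andP[k0 kC] := excess_le n i w; rewrite ger0_norm.
Qed.

Let Good_mul_int (f : T -> R) : P.-integrable [set: T] (EFin \o f) ->
  P.-integrable [set: T] (EFin \o (fun w => \1_Good w * f w)).
Proof.
apply: (@integrable_bounded_mul _ _ _ P 1); first exact: measurable_indic.
by move=> w; rewrite indicE; case: (_ \in _); rewrite ?normr1 ?normr0.
Qed.

Let Q_telescope n w :
  \sum_(i < n.+1) (Q (tm n i.+1) w - Q (tm n i) w) = Q t w - Q s w.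
Proof.
rewrite -[in RHS](tm_last n) -[in RHS](tm_first n); elim: n.+1 => [|j IH].
  by rewrite big_ord0 subrr.
by rewrite big_ord_recr/= IH addrC subrKA.
Qed.

(** The isometry is followed by c^2 <= m^2 + excess; the m^2 terms telescope to Q_t - Q_s. *)
Let I_sq_le n : \int[P]_w (I n w ^+ 2) <= K.
Proof.
have [_ [hM hM2 _ _] _] := hDM; have [[_ iQ _ _ _] _ hMQ] := hQ.
rewrite /I (transform_sq fF hM hM2 iQ hMQ (tm0 n) (@tmS n) (mc n) (cC n)).
rewrite -(@Rintegral_sum _ _ _ P n.+1
  (fun i w => c n i w ^+ 2 * (Q (tm n i.+1) w - Q (tm n i) w))); last first.
  by move=> i _; exact: c2_int.
have iS := integrable_real_sum (fun i (_ : (i < n.+1)%N) => c2_int n i).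
have ik := integrable_real_sum (fun i (_ : (i < n.+1)%N) => excess_int n i).
have iQQ : P.-integrable [set: T] (EFin \o (fun w => m%:R ^+ 2 * (Q t w - Q s w))).
  by apply: integrable_realZ; apply: integrable_realB; exact: Qint.
have -> : \int[P]_w (\sum_(i < n.+1) c n i w ^+ 2 * (Q (tm n i.+1) w - Q (tm n i) w)) =
   \int[P]_w (\1_Good w * (\sum_(i < n.+1) c n i w ^+ 2 * (Q (tm n i.+1) w - Q (tm n i) w))).
  congr fine; apply: ae_eq_integral => //.
  - exact: measurable_int iS.
  - exact: measurable_int (Good_mul_int iS).
  - by apply: filterS good_ae => w gw _ /=; rewrite indicE mem_set// mul1r.
apply: (@le_trans _ _ (\int[P]_w (\1_Good w * (m%:R ^+ 2 * (Q t w - Q s w)) +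
   \1_Good w * (\sum_(i < n.+1) excess n i w * (Q (tm n i.+1) w - Q (tm n i) w))))).
  apply: le_Rintegral => //; first exact: Good_mul_int.
    by apply: integrable_realD; exact: Good_mul_int.
  move=> w _; rewrite -mulrDr indicE.
  have [/set_mem gw|_] := boolP (w \in Good); last by rewrite !mul0r.
  rewrite !mul1r -(Q_telescope n) mulr_sumr -big_split/=; apply: ler_sum => i _.
  rewrite -mulrDl; apply: ler_wpM2r; last by rewrite /excess; max_lra.
  by have [_ _ _ [Qnd _] _] := gw; rewrite subr_ge0 Qnd.
rewrite RintegralD//; [|exact: Good_mul_int|exact: Good_mul_int].
rewrite lerD2l; apply: fine_le; [|exact: energy_fin|exact: excess_energy].
by apply: integrable_fin_num => //; exact: Good_mul_int.
Qed.

Let increment_lower w : E w -> good w -> forall delta, 0 < delta ->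
  \forall n \near \oo, I n w <=
    Zproc X A eps phi alpha t w - Zproc X A eps phi alpha s w + delta.
Proof.
move=> Ew gw delta delta0; have [cX ME A0 _ _] := gw.
have Ss0 : 0 < Smax s w by exact: Smax_gt0.
have Sst : Smax s w <= Smax t w by apply: Smax_nd => //; exact: ltW.
set p0 := phi (Smax s w); set pt := phi (Smax t w).
have ptp0 : pt <= p0 by exact: phi_ni.
have p1 : 0 < p0 - pt + 1 by lra.
(* The + 1 keeps the denominator positive when [p0 = pt]; the error of the summation by parts is
   then [delta] minus this quantity. *)
have d'0 : 0 < delta / (p0 - pt + 1) by exact: divr_gt0.
have ts0 : 0 <= t - s by rewrite subr_ge0 ltW.
near=> n.
have hmod : forall u v, 0 <= u -> u <= t -> 0 <= v -> v <= t ->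
    `|u - v| <= (t - s) / n.+1%:R -> `|X u w - X v w| <= delta / (p0 - pt + 1).
  by near: n; exact: (path_unif_cont cX t d'0 ts0).
(* From here on the truncation at -n is inactive along the path, since phi(S) >= pt up to time t. *)
have hn : - pt <= n%:R by near: n; exact: nbhs_infty_ger.
have IE : I n w = \sum_(i < n.+1) phi (Smax (tm n i) w) * (M (tm n i.+1) w - M (tm n i) w).
  apply: eq_bigr => i _; congr (_ * _); rewrite /c indicE mem_set ?mul1r; last exact: EB.
  rewrite max_l// lerNl (le_trans _ hn)// lerN2; apply: phi_ni.
    by apply: Smax_gt0; exact: le_trans (tm_ge n i).
  by apply: Smax_nd => //; apply: tm_le; exact: ltnW.
have := @abel_Phi_ge _ phi phiC1 phi_ni (fun i => Smax (tm n i) w) (fun i => M (tm n i) w)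
  (delta / (p0 - pt + 1)) n.+1.
rewrite /= -IE tm_first tm_last -/p0 -/pt => /(_ Ss0) h.
have {h} := h _ _ _.
have -> : delta / (p0 - pt + 1) * (p0 - pt) = delta - delta / (p0 - pt + 1).
  by field; rewrite gt_eqF.
move=> h.
have {}h : I n w - (delta - delta / (p0 - pt + 1)) <=
    pt * M t w - p0 * M s w + Phi phi (Smax t w) (Smax s w).
  apply: h.
  - by move=> i; exact: Smax_nd.
  - by move=> i; exact: M_le_Smax.
  - move=> i ni; rewrite !Smax_good//; apply: (sup_path_increment cX) => //; first exact: ltW.
    move=> r ir ri; apply: le_trans (ler_norm _) _.
    have r0 : 0 <= r by exact: le_trans ir.
    have rt : r <= t by apply: le_trans ri _; exact: tm_le.
    apply: hmod => //; first by apply: tm_le; exact: ltnW.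
    by rewrite ger0_norm ?subr_ge0// lerBlDl -tm_step.
rewrite !Zproc_good// /Zgood -/p0 -/pt.
have Se0 : 0 < Smax eps w by exact: Smax_gt0.
have Ses : Smax eps w <= Smax s w by apply: Smax_nd => //; exact: ltW.
rewrite (Phi_add phiC1 Se0 Ses Sst).
have PhiN : 0 <= (alpha - 1) * Phi phi (Smax t w) (Smax s w).
  by rewrite mulr_ge0 ?subr_ge0//; exact: Phi_ge0.
exact: increment_combine d'0 PhiN h.
Unshelve. all: by end_near. Qed.

Let Z := Zproc X A eps phi alpha.

Lemma increment_bound :
  (\int[P]_(w in E) (Num.max (Z s w - Z t w) 0)%:E < +oo)%E /\
  (\int[P]_(w in E) (Num.max (Z s w - Z t w) 0)%:E <=
   \int[P]_(w in E) (Num.max (Z t w - Z s w) 0)%:E)%E.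
Proof.
have [_ [hM hM2 _ _] _] := hDM; have [[_ iQ _ _ _] _ hMQ] := hQ.
have mE : measurable E by exact: (filtration_measurable fF s0).
have et : eps <= t by rewrite (le_trans es)// ltW.
have mD : measurable_fun [set: T] (fun w => Z t w - Z s w).
  apply: measurable_funB.
    exact: (filtration_fun fF t0 (Zproc_measurable et)).
  exact: (filtration_fun fF s0 (Zproc_measurable es)).
have sI n : sq_int P (I n).
  exact: (transform_sq_int fF hM hM2 (tm0 n) (mc n) (cC n)).
have K0 : 0 <= K.
  by apply: le_trans (I_sq_le 0); apply: Rintegral_ge0 => w _; exact: sqr_ge0.
have := @neg_part_le_pos_part _ _ _ P E _ K mE mD K0.
under [X in (X < _)%E]eq_integral do rewrite opprB.
under [X in (X <= _)%E]eq_integral do rewrite opprB.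
apply => k k0.
apply: (@fatou_bound _ _ _ P E _ I K mE mD sI I_sq_le) => //.
- move=> n; apply: (transform_mean fF hM hM2 (tm0 n) (@tmS n) (mc n) (cC n)).
    rewrite tm_first; apply/(measurable_wrtP (filtration_sigma fF s0)).
    by apply: measurable_indic; apply/(measurable_wrt_setP (filtration_sigma fF s0)).
  by move=> w; rewrite indicE; case: (_ \in _); rewrite ?normr1 ?normr0.
- by apply: filterS good_ae => w gw Ew; exact: increment_lower.
Qed.

End Increment.

Lemma Zproc_gen_submartingale :
  gen_submartingale P eps F (Zproc X A eps phi alpha).
Proof.
split=> [u eu|s t es st]; first exact: Zproc_measurable.
have s0 := le_trans (ltW heps) es; have t0 := le_trans s0 st.
have et := le_trans es st.
apply: (@cond_exp_ge _ _ _ P (F s) (filtration_sigma fF s0) (filtration_measurable fF s0) _ _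
  (fun m => [set w | phi (Smax s w) <= m%:R])).
- exact: Zproc_measurable.
- exact: (filtration_fun fF t0 (Zproc_measurable et)).
- move=> m; rewrite (_ : [set w | _] = (phi \o Smax s) @^-1` `]-oo, m%:R]); last first.
    by apply/seteqP; split=> w /=; rewrite in_itv.
  exact: phi_Smax_measurable.
- move=> w; exists (Num.truncn `|phi (Smax s w)|).+1 => /=.
  by rewrite (le_trans (ler_norm _))// ltW// truncnS_gt.
(* For s = t the increment vanishes; the partition is built for s < t. *)
- move=> m E FE EB; move: st; rewrite le_eqVlt => /predU1P[<-|st]; last first.
    exact: increment_bound EB.
  under eq_integral do rewrite subrr maxxx.
  by rewrite integral0.
Qed.

End MainEstimate.

(** * Change of sign of the function *)

Section Opposite.
Context {R : realType}.
Variable phi : R -> R.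
Hypotheses (phiC1 : C1_pos phi).

Lemma derive1_opp (x : R) : 0 < x -> derive1 (fun y => - phi y) x = - derive1 phi x.
Proof. by move=> x0; rewrite !derive1E deriveN//; exact: (phiC1 x0).1. Qed.

Lemma C1_pos_opp : C1_pos (fun y => - phi y).
Proof.
move=> x x0; have [dphi cphi] := phiC1 x0; split; first exact: derivableN.
change (derive1 (fun y => - phi y) y @[y --> x] --> derive1 (fun y => - phi y) x).
rewrite derive1_opp//.
apply: cvg_trans (cvgN cphi); apply: near_eq_cvg; near=> y.
by rewrite /= derive1_opp//; near: y; exact: lt_nbhsr.
Unshelve. all: by end_near. Qed.

Lemma Phi_opp (x z : R) : 0 < z -> Phi (fun y => - phi y) x z = - Phi phi x z.
Proof.
move=> z0; rewrite /Phi opprK.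
under eq_Rintegral => y /set_mem /= yzx.
  rewrite derive1_opp; last by move: yzx; rewrite in_itv/= => /andP[+ _]; exact: lt_le_trans.
  rewrite mulrN -mulN1r; over.
rewrite RintegralZl//; last exact: id_phi_derive_integrable.
by rewrite mulN1r opprK.
Qed.

End Opposite.

Theorem theorem2 (R : realType) (d : measure_display) (T : measurableType d)
    (P : probability T R) (F : R -> set (set T)) (X M A Q : R -> T -> R)
    (eps : R)
    (hF : usual_conditions P F)
    (hX : submartingale P 0 F X)
    (hXc : continuous_paths P X)
    (hX0 : {ae P, forall w, X 0 w = 0})
    (hXpos : {ae P, forall w, forall t : R, 0 <= t -> 0 <= X t w})
    (hDM : doob_meyer P F X M A)
    (hQ : quadratic_variation P F M Q)
    (hXmax : forall t : R, 0 < t -> {ae P, forall w, 0 < running_max X t w})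
    (heps : 0 < eps) :
  (forall phi : R -> R,
     C1_pos phi -> nonincreasing_pos phi -> finite_energy P eps phi X Q ->
     forall alpha : R, 1 <= alpha ->
       gen_submartingale P eps F (Zproc X A eps phi alpha)) /\
  (forall phi : R -> R,
     C1_pos phi -> nondecreasing_pos phi -> finite_energy P eps phi X Q ->
     forall alpha : R, 1 <= alpha ->
       gen_supermartingale P eps F (Zproc X A eps phi alpha)).
Proof.
have aX : adapted 0 F X by have [_ []] := hX.
have sub (phi : R -> R) : C1_pos phi -> nonincreasing_pos phi ->
    finite_energy P eps phi X Q -> forall alpha : R, 1 <= alpha ->
    gen_submartingale P eps F (Zproc X A eps phi alpha).
  by move=> *; exact: (Zproc_gen_submartingale hF aX hXc hDM hQ hXmax heps).
split=> // phi phiC1 phi_nd en alpha alpha1.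
apply: (@gen_super_of_opp _ _ _ _ _ hF _ _ (Zproc X A eps (fun y => - phi y) alpha)).
- exact: ltW.
(* The sign rule for [Phi] needs a positive lower limit of integration, which the running maximum at
   time [eps] is almost surely. *)
- move=> t et; apply: filterS (hXmax eps heps) => w Se.
  by rewrite /Zproc Phi_opp// mulNr mulrN opprD.
- apply: (sub _ (C1_pos_opp phiC1) _ _ _ alpha1).
    by move=> x y x0 xy; rewrite lerN2; exact: phi_nd.
  move=> t et; under eq_integral do under eq_integral do rewrite sqrrN.
  exact: en.
Qed.
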